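(* Let $p,q\ge0$ be integers with $n=p+q\ge1$. Let $\sigma:\mathcal{M}\to\mathbb{S}^{p+1}\times\mathbb{S}^q$ be an immersed, oriented hypersurface of class $C^4$ whose induced metric has signature $(p,q)$. Denote by $\nu$ its Gauss map (hence an $\mathbb{S}^{n+2}_{p+1}$-valued map) and by $A=-d\nu$ the corresponding shape operator. Denote by $\tau_i$ the roots of the polynomial of degree $n-1$ given, up to the non-vanishing factor $\det(\tau\,\mathrm{Id}-A)$, by $$P(\tau)=\mathrm{tr}\big((\tau\,\mathrm{Id}-A)^{-1}\big).$$ Then the immersions $\varphi_i:\mathcal{M}\to\mathbb{S}^{n+2}_{p+1}$ defined by $\varphi_i:=\nu+\tau_i\sigma$ are marginally trapped. Conversely, any connected, marginally trapped $n$-dimensional submanifold of $\mathbb{S}^{n+2}_{p+1}$, with induced metric of signature $(p,q)$, whose mean Gauss map has maximal rank is the image of such an immersion.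
   Context: $\mathbb{R}^{n+3}_{p+2}$ denotes $\mathbb{R}^{n+3}=\mathbb{R}^{p+2}\times\mathbb{R}^{q+1}$ with $\langle\cdot,\cdot\rangle=\sum_{i=1}^{p+2}dx_i^2-\sum_{i=p+3}^{n+3}dx_i^2$, and $\mathbb{S}^{n+2}_{p+1}=\{x\in\mathbb{R}^{n+3}_{p+2}:\langle x,x\rangle=1\}$ with the induced metric of signature $(p+1,q+1)$. $\mathbb{S}^{p+1}\times\mathbb{S}^q\subset\mathbb{R}^{p+2}\times\mathbb{R}^{q+1}$ (Euclidean unit spheres) carries the metric induced by $\langle\cdot,\cdot\rangle$, of signature $(p+1,q)$. The Gauss map $\nu$ of $\sigma$ is its unit normal field within $\mathbb{S}^{p+1}\times\mathbb{S}^q$: $\nu\in T_\sigma(\mathbb{S}^{p+1}\times\mathbb{S}^q)$, $\langle\nu,\nu\rangle=1$, $\langle d\sigma,\nu\rangle=0$. The shape operator $A$ is defined by $AX=-(d\nu(X))^\top$, with $\top$ the projection on the tangent space of the hypersurface. A root $\tau_i$ means a real-valued function of class $C^2$ on $\mathcal{M}$ such that at each point $\tau_i\mathrm{Id}-A$ is invertible and $P(\tau_i)=0$ (invertibility being equivalent to non-degeneracy of the metric induced by $\varphi_i$). Submanifolds have codimension two in $\mathbb{S}^{n+2}_{p+1}$, non-degenerate induced metric of signature $(p,q)$, hence Lorentzian two-dimensional normal bundle. The mean curvature vector $\vec H$ is $\frac1n$ times the trace of the second fundamental form; marginally trapped means $\langle\vec H,\vec H\rangle=0$, i.e. $\vec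 H$ lies in one of the two null lines of the normal space. The mean Gauss map is the null normal vector field collinear to $\vec H$ normalized so as to take values in $\mathbb{S}^{p+1}\times\mathbb{S}^q$; it has maximal rank if its differential has rank $n$ everywhere.
   Formalization: In the converse, whose regularity is unspecified, the mean Gauss map is assumed of class C^4 or the submanifold of class C^5; without this the hypersurface, which must be the mean Gauss map up to sign, need not be of class C^4. *)

(* Defs.v *)
From mathcomp Require Import all_boot all_order all_algebra.
From mathcomp Require Import all_classical all_reals all_analysis.
Set Implicit Arguments.
Unset Strict Implicit.
Unset Printing Implicit Defensive.
Import Order.TTheory GRing.Theory Num.Theory.
Import numFieldNormedType.Exports.
Local Open Scope classical_set_scope.
Local Open Scope ring_scope.

(* Functions of class C^k on U; only used for open U, where C^(k+1) means
   differentiable with all directional derivatives of class C^k. *)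
Fixpoint class_C (R : realType) (V W : normedModType R) (k : nat) (U : set V)
    (f : V -> W) : Prop :=
  match k with
  | 0%N => forall x, U x -> {for x, continuous f}
  | k'.+1 => (forall x, U x -> differentiable f x) /\
             (forall v, class_C k' U (fun x => 'D_v f x))
  end.

(* The values of chart_map outside chart_dom, and of chart_inv outside
   chart_im, are irrelevant. *)
Record chart (R : realType) (n : nat) (M : topologicalType) := Chart {
  chart_dom : set M;
  chart_im : set 'rV[R]_n;
  chart_map : M -> 'rV[R]_n;
  chart_inv : 'rV[R]_n -> M;
  chart_dom_open : open chart_dom;
  chart_im_open : open chart_im;
  chart_map_im : forall x, chart_dom x -> chart_im (chart_map x);
  chart_inv_dom : forall y, chart_im y -> chart_dom (chart_inv y);
  chart_mapK : forall x, chart_dom x -> chart_inv (chart_map x) = x;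
  chart_invK : forall y, chart_im y -> chart_map (chart_inv y) = y;
  chart_map_cont : forall x, chart_dom x -> {for x, continuous chart_map};
  chart_inv_cont : forall y, chart_im y -> {for y, continuous chart_inv}
}.

(* n-dimensional manifolds of class C^k without boundary; the atlas need not be
   maximal. *)
Record manifold (R : realType) (n k : nat) := Manifold {
  carrier :> topologicalType;
  manifold_hausdorff : hausdorff_space carrier;
  manifold_second_countable : @second_countable carrier;
  atlas : set (chart R n carrier);
  atlas_cover : forall x : carrier, exists2 c, atlas c & chart_dom c x;
  atlas_compat : forall c c', atlas c -> atlas c' ->
    class_C k (chart_im c `&` chart_inv c @^-1` chart_dom c')
      (chart_map c' \o chart_inv c)
}.

Arguments atlas {R n k} m.

Section Maps.
Context (R : realType) (n k : nat) (M : manifold R n k).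

(* Meaningful for m <= k, or whenever f is an immersion: charts in which an
   immersion is of class C^m are automatically C^m-compatible. *)
Definition of_class (W : normedModType R) (m : nat) (f : M -> W) : Prop :=
  forall c, atlas M c -> class_C m (chart_im c) (f \o chart_inv c).

(* The differential at x in the coordinates of c; row i is the partial
   derivative d_i f (x). *)
Definition jac (N : nat) (c : chart R n M) (f : M -> 'rV[R]_N) (x : M)
    : 'M[R]_(n, N) :=
  'J (f \o chart_inv c) (chart_map c x).

Definition partial2 (N : nat) (c : chart R n M) (f : M -> 'rV[R]_N) (x : M)
    (i j : 'I_n) : 'rV[R]_N :=
  'D_(delta_mx 0 i) (fun y => 'D_(delta_mx 0 j) (f \o chart_inv c) y)
    (chart_map c x).

Definition maximal_rank (N : nat) (f : M -> 'rV[R]_N) : Prop :=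
  forall c x, atlas M c -> chart_dom c x ->
    differentiable (f \o chart_inv c) (chart_map c x) /\ \rank (jac c f x) = n.

Definition immersion (N m : nat) (f : M -> 'rV[R]_N) : Prop :=
  of_class m f /\ maximal_rank f.

End Maps.

Definition dot (R : realType) (a : nat) (u v : 'rV[R]_a) : R :=
  \sum_i u 0 i * v 0 i.

(* A symmetric g has signature (p, q) when it becomes diag(1,..,1,-1,..,-1) in
   some basis. *)
Definition has_signature (R : realType) (p q : nat) (g : 'M[R]_(p + q)) : Prop :=
  exists2 B : 'M[R]_(p + q), B \in unitmx &
    B *m g *m B^T = block_mx 1%:M 0 0 (- 1%:M).

Section Ambient.
Context (R : realType) (a b : nat).
Local Notation E := 'rV[R]_(a + b).

Definition ip (u v : E) : R :=
  dot (lsubmx u) (lsubmx v) - dot (rsubmx u) (rsubmx v).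

Definition in_pseudosphere (u : E) : Prop := ip u u = 1.

Definition in_sphere_product (u : E) : Prop :=
  dot (lsubmx u) (lsubmx u) = 1 /\ dot (rsubmx u) (rsubmx u) = 1.

Definition tangent_sphere_product (u v : E) : Prop :=
  dot (lsubmx u) (lsubmx v) = 0 /\ dot (rsubmx u) (rsubmx v) = 0.

Section Immersed.
Context (n k : nat) (M : manifold R n k).
Implicit Types (c : chart R n M) (f : M -> E) (x : M).

Definition metric c f x : 'M[R]_n :=
  \matrix_(i, j) ip (row i (jac c f x)) (row j (jac c f x)).

(* tan_coord c f x v is the row of coordinates, in the basis d_1 f, .., d_n f,
   of the <.,.>-orthogonal projection of v on the tangent space of f at x
   (assuming the induced metric is non-degenerate at x). *)
Definition tan_coord c f x (v : E) : 'rV[R]_n :=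
  (\row_j ip v (row j (jac c f x))) *m invmx (metric c f x).

Definition tan_proj c f x (v : E) : E := tan_coord c f x v *m jac c f x.

(* Second fundamental form, within the pseudosphere, of f valued in the
   pseudosphere: component of d_i d_j f orthogonal to f and to d f. *)
Definition second_form c f x (i j : 'I_n) : E :=
  let w := partial2 c f x i j in w - ip w (f x) *: f x - tan_proj c f x w.

Definition mean_curvature c f x : E :=
  n%:R^-1 *: \sum_i \sum_j invmx (metric c f x) i j *: second_form c f x i j.

(* Unit normal field of sigma within the product of spheres. Continuity is what
   encodes the orientation of the hypersurface (choice of a side); the
   regularity of nu is then inherited from that of d sigma. *)
Definition gauss_map (sigma nu : M -> E) : Prop :=
  continuous nu /\
  forall x, [/\ tangent_sphere_product (sigma x) (nu x),
    ip (nu x) (nu x) = 1 &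
    forall c, atlas M c -> chart_dom c x ->
      forall i, ip (row i (jac c sigma x)) (nu x) = 0].

(* Matrix of A X = - (d nu X)^T, acting on rows of coordinates X from the
   right. *)
Definition shape_operator c (sigma nu : M -> E) x : 'M[R]_n :=
  - \matrix_(i < n) tan_coord c sigma x (row i (jac c nu x)).

Definition P_of (A : 'M[R]_n) (t : R) : R := \tr (invmx (t%:M - A)).

Definition is_root (sigma nu : M -> E) (tau : M -> R^o) : Prop :=
  of_class 2 tau /\
  forall c x, atlas M c -> chart_dom c x ->
    (tau x)%:M - shape_operator c sigma nu x \in unitmx /\
    P_of (shape_operator c sigma nu x) (tau x) = 0.

Definition phi_of (sigma nu : M -> E) (tau : M -> R^o) : M -> E :=
  fun x => nu x + (tau x : R) *: sigma x.

(* Null normal vector field of f within the pseudosphere, collinear to the mean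
   curvature vector; it is null because it is valued in the product of
   spheres. *)
Definition mean_gauss_map (f gam : M -> E) : Prop :=
  continuous gam /\
  forall x, [/\ in_sphere_product (gam x), ip (gam x) (f x) = 0 &
    forall c, atlas M c -> chart_dom c x ->
      (forall i, ip (gam x) (row i (jac c f x)) = 0) /\
      exists l : R, mean_curvature c f x = l *: gam x].

End Immersed.
End Ambient.

Section Hypersurfaces.
Context (R : realType) (p q k : nat) (M : manifold R (p + q) k).
Local Notation E := 'rV[R]_(p.+2 + q.+1).

Definition induced_signature (f : M -> E) : Prop :=
  forall c x, atlas M c -> chart_dom c x -> has_signature (metric c f x).

Definition oriented_hypersurface (sigma nu : M -> E) : Prop :=
  [/\ immersion 4 sigma, forall x, in_sphere_product (sigma x),
      induced_signature sigma & gauss_map sigma nu].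

Definition marginally_trapped (f : M -> E) : Prop :=
  [/\ immersion 2 f, forall x, in_pseudosphere (f x), induced_signature f &
      forall c x, atlas M c -> chart_dom c x ->
        ip (mean_curvature c f x) (mean_curvature c f x) = 0].

End Hypersurfaces.

(* Main.v *)
Require Import Defs.
From HB Require Import structures.
From mathcomp Require Import all_boot all_order all_algebra.
From mathcomp Require Import all_classical all_reals all_analysis.
Import Order.TTheory GRing.Theory Num.Theory.
Import numFieldNormedType.Exports.
Local Open Scope classical_set_scope.
Local Open Scope ring_scope.
Set Implicit Arguments.
Unset Strict Implicit.
Unset Printing Implicit Defensive.

(* The vectors nu, sigma and the derivatives of sigma span a hyperplane whose
   orthogonal line is spanned by the null vector sigma. Hence
   d nu = - A d sigma mod sigma, so phi = nu + tau sigma satisfies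
   d phi = (tau - A) d sigma mod sigma and induces the metric
   (tau - A) g (tau - A)^T. As sigma is normal to phi, differentiating
   <d phi, sigma> = 0 gives n <H, sigma> = - tr ((tau - A)^-1); at a root H is
   thus orthogonal to sigma in a Lorentzian plane containing the null vector
   sigma, so it is a multiple of sigma.

   Conversely sigma is the mean Gauss map, tau is the Euclidean product of the
   R^(p+2)-components of sigma and f, and nu = f - tau sigma.

   The Gauss map is only assumed continuous, and so is the mean Gauss map when
   f is of class C^5; their regularity comes from the linear and quadratic
   equations which determine them locally. *)

(** * Functions of class C^k *)

Section Differentials.
Context (R : realType) (V : normedModType R).

(** Write f g = f (g - g x) + g x f. Near x the factor f is O(h) and g - g x tends to 0, so the
    first term is o(h). This is the source of differentiability from mere continuity, for inverses
    and for implicit solutions alike. *)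
Lemma diff_mulr_vanish (f g : V -> R^o) (x : V) :
  differentiable f x -> f x = 0 -> {for x, continuous g} ->
  differentiable (fun y => f y * g y : R^o) x.
Proof.
move=> df fx0 cg.
pose e : V -> R^o := fun y => f y * (g y - g x).
have cdf : continuous ('d f x) by exact: diff_continuous.
have [k k0 kP] := linear_lipschitz cdf.
have eo : e \o shift x = cst (e x) + (\0 : {linear V -> R^o}) +o_ 0 id.
  apply/eqaddoP => _/posnumP[ep].
  have fo : \forall h \near (0 : V), `|f (h + x) - 'd f x h| <= `|h|.
    have /eqaddoP/(_ _ ltr01) := diff_locally df.
    by under eq_near do
      rewrite mul1r -![(_ + _ : _ -> _) _]/(_ + _) -![(- _ : _ -> _) _]/(- _)
        /= /cst -![(_ + _ : _ -> _) _]/(_ + _) fx0 add0r.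
  (* The tolerance [ep / (k + 1)] offsets the bound (k + 1)|h| on f (h + x), where k bounds the
     differential and 1 the remainder. *)
  have gx : \forall h \near (0 : V), `|g x - g (h + x)| < ep%:num / (k + 1).
    have : (g \o shift x) @ (0:V) --> g x by rewrite cvg_comp_shift add0r.
    move/cvgrPdist_lt; apply; rewrite divr_gt0// addr_gt0//.
  near=> h.
  rewrite /e /=.
  rewrite -![(_ + _ : _ -> _) _]/(_ + _) -![(- _ : _ -> _) _]/(- _) /= /cst.
  rewrite fx0 mul0r !addr0 subr0.
  have h1 : `|f (h + x)| <= (k + 1) * `|h|.
    rewrite -[f _](subrK ('d f x h)) mulrDl mul1r [leRHS]addrC.
    apply: le_trans (ler_normD _ _) _; apply: lerD; last exact: kP.
    by near: h.
  rewrite normrM; have h2 : `|g (h + x) - g x| <= ep%:num / (k + 1).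
    by rewrite distrC ltW//; near: h.
  apply: le_trans (ler_pM _ _ h1 h2) _ => //.
  by rewrite mulrAC mulrCA divff ?mulr1 ?gt_eqF ?addr_gt0.
Unshelve. 2: by end_near.
have de : differentiable e x.
  apply/diff_locallyP; have ed : 'd e x = (\0 : {linear V -> R^o}) :> (V -> R^o).
    by apply: diff_unique => // y; exact: cst_continuous.
  by rewrite ed; split => // y; exact: cst_continuous.
have -> : (fun y => f y * g y : R^o) = e + g x *: f.
  apply/funext => y; rewrite -![(_ + _ : _ -> _) _]/(_ + _).
  rewrite -[(_ *: _ : _ -> _) _]/(g x *: f y) /e mulrBr /GRing.scale /=.
  by rewrite (mulrC (g x)) subrK.
by apply: (differentiableD de); exact: (differentiableZ (g x) df).
Qed.

Lemma differentiable_mx m n (F : V -> 'M[R]_(m, n)) (x : V) :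
  differentiable F x <-> forall i j, differentiable (fun y => F y i j : R^o) x.
Proof.
split=> [dF i j|dF].
  exact: (@differentiable_comp _ _ _ _ F (fun M : 'M[R]_(m, n) => M i j : R^o)
    _ dF (differentiable_coord _ i j)).
have -> : F = \sum_i \sum_j (fun y => F y i j *: delta_mx i j).
  apply/funext => y; rewrite fct_sumE {1}[F y]matrix_sum_delta.
  by apply: eq_bigr => i _; rewrite fct_sumE.
apply: differentiable_sum => i; apply: differentiable_sum => j.
exact: differentiableZl.
Qed.

Lemma derive_coord m n (F : V -> 'M[R]_(m, n)) (x v : V) i j :
  differentiable F x -> ('D_v F x) i j = 'D_v (fun y => F y i j : R^o) x.
Proof. by move=> dF; rewrite derive_mx ?mxE//; exact: diff_derivable. Qed.

Lemma differentiable_bigsum (I : Type) (r : seq I) (f : I -> V -> R^o) (x : V) :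
  (forall i, differentiable (f i) x) ->
  differentiable (fun y => \sum_(i <- r) f i y : R^o) x.
Proof.
move=> df; have -> : (fun y => \sum_(i <- r) f i y : R^o) = \sum_(i <- r) f i.
  by apply/funext => y; rewrite fct_sumE.
by elim/big_ind : _ => // g h; exact: differentiableD.
Qed.

Lemma continuous_mx m n (F : V -> 'M[R]_(m, n)) (x : V) :
  {for x, continuous F} <-> forall i j, {for x, continuous (fun y => F y i j : R^o)}.
Proof.
split=> [cF i j|cF].
  exact: (@continuous_comp _ _ _ F (fun M : 'M[R]_(m, n) => M i j : R^o) x cF
    (@coord_continuous _ _ _ i j _)).
apply/cvgrPdist_le => e e0; near=> y.
rewrite /Num.Def.normr/= mx_normrE (bigmax_le _ (ltW e0))//= => i _.
rewrite !mxE /=.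
move: i; near: y; apply: filter_forall => /= i.
exact: ((cvgrPdist_le _ _).1 (cF i.1 i.2)).
Unshelve. all: by end_near. Qed.

Lemma differentiable_mulmx m n k (F : V -> 'M[R]_(m, n)) (G : V -> 'M[R]_(n, k)) x :
  differentiable F x -> differentiable G x ->
  differentiable (fun y => F y *m G y) x.
Proof.
move=> /differentiable_mx dF /differentiable_mx dG; apply/differentiable_mx => i j.
under eq_fun do rewrite mxE.
by apply: differentiable_bigsum => l; exact: differentiableM.
Qed.

Lemma derive_mulmx m n k (F : V -> 'M[R]_(m, n)) (G : V -> 'M[R]_(n, k)) x v :
  differentiable F x -> differentiable G x ->
  'D_v (fun y => F y *m G y) x = 'D_v F x *m G x + F x *m 'D_v G x.
Proof.
move=> dF dG; have dF' := (differentiable_mx _ _).1 dF.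
have dG' := (differentiable_mx _ _).1 dG.
apply/matrixP => i j; rewrite derive_coord; last exact: differentiable_mulmx.
rewrite !mxE -big_split /=.
have -> : (fun y => (F y *m G y) i j : R^o) =
    \sum_l ((fun y => F y i l : R^o) * (fun y => G y l j : R^o)).
  by apply/funext => y; rewrite mxE fct_sumE.
rewrite derive_sum => [|l]; last first.
  by apply: derivableM; exact: diff_derivable.
apply: eq_bigr => l _; rewrite deriveM; [|exact: diff_derivable..].
by rewrite !derive_coord// addrC /GRing.scale /= (mulrC (G x l j)).
Qed.

Lemma differentiable_mulmx_vanish m n k (F : V -> 'M[R]_(m, n))
    (G : V -> 'M[R]_(n, k)) x :
  differentiable F x -> F x = 0 -> {for x, continuous G} ->
  differentiable (fun y => F y *m G y) x.
Proof.
move=> /differentiable_mx dF Fx0 /continuous_mx cG; apply/differentiable_mx => i j.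
under eq_fun do rewrite mxE.
apply: differentiable_bigsum => l; apply: diff_mulr_vanish => //.
by rewrite Fx0 mxE.
Qed.

End Differentials.

(** * Stability of class C^k and regularity of implicit solutions *)

Section ClassC.
Context (R : realType) (V : normedModType R).

Lemma continuous_mulmx m n k (F : V -> 'M[R]_(m, n)) (G : V -> 'M[R]_(n, k)) x :
  {for x, continuous F} -> {for x, continuous G} ->
  {for x, continuous (fun y => F y *m G y)}.
Proof.
move=> /continuous_mx cF /continuous_mx cG; apply/continuous_mx => i j.
rewrite /prop_for /continuous_at mxE; under eq_cvg do rewrite mxE.
apply: cvg_big => [|l _]; first exact: add_continuous.
by apply: cvgM; [exact: cF|exact: cG].
Qed.

Lemma continuous_det n (F : V -> 'M[R]_n) x : {for x, continuous F} ->
  {for x, continuous (fun y => \det (F y) : R^o)}.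
Proof.
move=> /continuous_mx cF; rewrite /prop_for /continuous_at.
apply: cvg_big => [|s _]; first exact: add_continuous.
apply: cvgM; first exact: cvg_cst.
apply: cvg_big => [|i _]; last exact: cF.
exact: mul_continuous.
Qed.

Lemma continuous_invmx n (F : V -> 'M[R]_n) x : {for x, continuous F} ->
  F x \in unitmx -> {for x, continuous (fun y => invmx (F y))}.
Proof.
move=> cF; rewrite unitmxE unitfE => F0.
have cdet := continuous_det cF.
rewrite /prop_for /continuous_at /invmx unitmxE unitfE F0.
have -> : nbhs ((\det (F x))^-1 *: \adj (F x)) =
  nbhs ((fun y => (\det (F y))^-1 *: \adj (F y)) x) by [].
(* [invmx] is defined by cases; near x the determinant stays nonzero, so only the adjugate formula
   occurs. *)
apply: (@cvg_trans _ ((fun y => (\det (F y))^-1 *: \adj (F y)) @ x)).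
  apply: near_eq_cvg; near=> y.
  rewrite unitmxE unitfE ifT//; near: y.
  have := cdet; move/cvgr_neq0; exact.
apply: cvgZ; first exact: cvgV.
apply/(@continuous_mx _ _ _ _ (fun y => \adj (F y))) => i j.
rewrite /prop_for /continuous_at mxE; under eq_cvg do rewrite mxE.
apply: cvgM; first exact: cvg_cst.
apply: continuous_det; apply/continuous_mx => k l.
rewrite /prop_for /continuous_at !mxE; under eq_cvg do rewrite !mxE.
by move/continuous_mx : cF; apply.
Unshelve. all: by end_near. Qed.

Lemma near_eq_differentiable (W : normedModType R) (f g : V -> W) x :
  {near x, f =1 g} -> differentiable f x -> differentiable g x.
Proof.
move=> fg df.
have gx : g x = f x by rewrite (nbhs_singleton fg).
have go : g \o shift x = cst (g x) + 'd f x +o_ 0 id.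
  apply/eqaddoP => e e0; have /eqaddoP/(_ e e0) := diff_locally df.
  have fg0 : \forall h \near (0 : V), f (h + x) = g (h + x).
    by move: fg; rewrite (near_shift 0) subr0.
  by apply: filter_app; near=> h; rewrite -![(_ + _ : _ -> _) _]/(_ + _)
    -![(- _ : _ -> _) _]/(- _) /= /cst -![(_ + _ : _ -> _) _]/(_ + _) gx
    (near fg0 h).
have dgf : 'd g x = 'd f x :> (V -> W).
  by apply: diff_unique => //; exact: diff_continuous.
by apply/diff_locallyP; rewrite dgf; split=> //; exact: diff_continuous.
Unshelve. all: by end_near. Qed.

(* F^-1(y) - F^-1(x) = - F^-1(x) (F(y) - F(x)) F^-1(y) near x *)
Lemma differentiable_invmx n (F : V -> 'M[R]_n) x : differentiable F x ->
  F x \in unitmx -> differentiable (fun y => invmx (F y)) x.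
Proof.
move=> dF Fx.
have cF := differentiable_continuous dF.
pose G y := - invmx (F x) *m ((F y - F x) *m invmx (F y)) + invmx (F x).
have Gd : differentiable G x.
  apply: (@differentiableD _ _ _
    (fun y => - invmx (F x) *m ((F y - F x) *m invmx (F y)))
    (fun=> invmx (F x))); last exact: differentiable_cst.
  apply: differentiable_mulmx; first exact: differentiable_cst.
  apply: (@differentiable_mulmx_vanish _ _ _ _ _ (fun y => F y - F x)).
  - by apply: (differentiableB dF); exact: differentiable_cst.
  - exact: subrr.
  - exact: continuous_invmx.
apply: near_eq_differentiable Gd; near=> y; rewrite /G.
rewrite mulmxBl mulmxV; last first.
  rewrite unitmxE unitfE; near: y.
  have := continuous_det cF; move/cvgr_neq0; apply.
  by rewrite -unitfE -unitmxE.
by rewrite mulNmx mulmxBr mulmx1 mulKmx// opprB subrK.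
Unshelve. all: by end_near. Qed.

(** Differentiate F^-1 F = 1, an identity valid near x because the determinant stays nonzero
    there. *)
Lemma derive_invmx n (F : V -> 'M[R]_n) x v : differentiable F x ->
  F x \in unitmx ->
  'D_v (fun y => invmx (F y)) x = - (invmx (F x) *m 'D_v F x *m invmx (F x)).
Proof.
move=> dF Fx; have dG := differentiable_invmx dF Fx.
have : 'D_v (fun y => invmx (F y) *m F y) x = 0.
  rewrite -[RHS](derive_cst (1%:M : 'M[R]_n) x v); apply: near_eq_derive.
  near=> y; rewrite mulVmx// unitmxE unitfE; near: y.
  have := continuous_det (differentiable_continuous dF).
  by move/cvgr_neq0; apply; rewrite -unitfE -unitmxE.
rewrite derive_mulmx// => /(canRL (addrK _)); rewrite sub0r => e.
by rewrite -[LHS](mulmxK Fx) e mulNmx.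
Unshelve. all: by end_near. Qed.

Lemma class_C_ext (W : normedModType R) k (U : set V) (f g : V -> W) : open U ->
  (forall x, U x -> f x = g x) -> class_C k U f -> class_C k U g.
Proof.
move=> oU; elim: k f g => [|k IH] f g fg.
  move=> cf x Ux; have := cf x Ux; rewrite /prop_for /continuous_at -fg//.
  apply: cvg_trans; apply: near_eq_cvg.
  by apply: filterS (open_nbhs_nbhs (conj oU Ux)) => y /fg.
have nfg x : U x -> {near x, f =1 g}.
  by move=> Ux; apply: filterS (open_nbhs_nbhs (conj oU Ux)) => y /fg.
move=> [df Df]; split=> [x Ux|v].
  by apply: near_eq_differentiable (df x Ux); exact: nfg.
apply: IH (Df v) => x Ux; apply: near_eq_derive; exact: nfg.
Qed.

Lemma class_CS (W : normedModType R) k (U : set V) (f : V -> W) :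
  class_C k.+1 U f -> class_C k U f.
Proof.
elim: k f => [|k IH] f [df Df].
  by move=> x Ux; exact: differentiable_continuous (df x Ux).
by split=> // v; apply: IH; exact: Df.
Qed.

Lemma class_C_le (W : normedModType R) k l (U : set V) (f : V -> W) :
  (k <= l)%N -> class_C l U f -> class_C k U f.
Proof.
move=> /subnK <-; elim: (l - k)%N => [//|m IH]; rewrite addSn => /class_CS.
exact: IH.
Qed.

Lemma class_C_differentiable (W : normedModType R) k (U : set V) (f : V -> W) x :
  (0 < k)%N -> class_C k U f -> U x -> differentiable f x.
Proof. by case: k => // k _ [df _]; exact: df. Qed.

Lemma class_C_cst (W : normedModType R) k (U : set V) (w : W) :
  class_C k U (fun=> w).
Proof.
elim: k w => [|k IH] w; first by move=> x _; exact: cst_continuous.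
split=> [x _|v]; first exact: differentiable_cst.
rewrite (_ : (fun x => 'D_v _ x) = fun=> 0); first exact: IH.
by apply/funext => x; exact: derive_cst.
Qed.

Lemma class_C_add (W : normedModType R) k (U : set V) (f g : V -> W) : open U ->
  class_C k U f -> class_C k U g -> class_C k U (fun x => f x + g x).
Proof.
move=> oU; elim: k f g => [|k IH] f g.
  by move=> cf cg x Ux; apply: cvgD; [exact: cf|exact: cg].
move=> [df Df] [dg Dg]; split=> [x Ux|v].
  exact: (differentiableD (df x Ux) (dg x Ux)).
apply: (class_C_ext oU _ (IH _ _ (Df v) (Dg v))) => x Ux.
have h := deriveD (@diff_derivable _ _ _ _ _ v (df x Ux))
  (@diff_derivable _ _ _ _ _ v (dg x Ux)).
exact: esym h.
Qed.

Lemma class_C_lin (W W' : normedModType R) k (U : set V) (L : {linear W -> W'})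
    (f : V -> W) : open U -> continuous L ->
  class_C k U f -> class_C k U (fun x => L (f x)).
Proof.
move=> oU cL; elim: k f => [|k IH] f.
  by move=> cf x Ux; apply: continuous_comp; [exact: cf|exact: cL].
move=> [df Df]; have dL w : differentiable L w by exact: linear_differentiable.
have dLf x : U x -> differentiable (L \o f) x.
  by move=> Ux; exact: (differentiable_comp (df x Ux) (dL _)).
split=> // v; apply: (class_C_ext oU _ (IH _ (Df v))) => x Ux.
rewrite (deriveE _ (dLf x Ux)) (deriveE _ (df x Ux)).
by rewrite (diff_comp (df x Ux) (dL _)) diff_lin.
Qed.

Lemma class_C_mulmx m n p k (U : set V) (F : V -> 'M[R]_(m, n))
    (G : V -> 'M[R]_(n, p)) : open U ->
  class_C k U F -> class_C k U G -> class_C k U (fun x => F x *m G x).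
Proof.
move=> oU; elim: k F G => [|k IH] F G.
  by move=> cF cG x Ux; apply: continuous_mulmx; [exact: cF|exact: cG].
move=> CF CG; have [[dF DF] [dG DG]] := (CF, CG); split=> [x Ux|v].
  exact: differentiable_mulmx (dF x Ux) (dG x Ux).
apply: (class_C_ext oU _ (class_C_add oU (IH _ _ (DF v) (class_CS CG))
  (IH _ _ (class_CS CF) (DG v)))) => x Ux.
exact/esym/(derive_mulmx _ (dF x Ux) (dG x Ux)).
Qed.

Lemma class_C_mull m n p k (U : set V) (A : 'M[R]_(m, n))
    (G : V -> 'M[R]_(n, p)) : open U ->
  class_C k U G -> class_C k U (fun x => A *m G x).
Proof. by move=> oU; apply: class_C_mulmx => //; exact: class_C_cst. Qed.

Lemma class_C_mulr m n p k (U : set V) (F : V -> 'M[R]_(m, n))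
    (A : 'M[R]_(n, p)) : open U ->
  class_C k U F -> class_C k U (fun x => F x *m A).
Proof. by move=> oU CF; apply: class_C_mulmx => //; exact: class_C_cst. Qed.

Lemma class_C_opp m n k (U : set V) (F : V -> 'M[R]_(m, n)) : open U ->
  class_C k U F -> class_C k U (fun x => - F x).
Proof.
move=> oU CF; apply: class_C_ext (class_C_mull (- 1%:M) oU CF) => // x _.
by rewrite mulNmx mul1mx.
Qed.

(** Bootstrap: the derivative - F^-1 (D F) F^-1 involves F^-1 undifferentiated, so class C^k of F^-1
    gives class C^(k+1). *)
Lemma class_C_invmx n k (U : set V) (F : V -> 'M[R]_n) : open U ->
  (forall x, U x -> F x \in unitmx) -> class_C k U F ->
  class_C k U (fun x => invmx (F x)).
Proof.
move=> oU uF; elim: k => [|k IH].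
  by move=> cF x Ux; apply: continuous_invmx; [exact: cF|exact: uF].
move=> CF; have [dF DF] := CF; have CI := IH (class_CS CF).
split=> [x Ux|v]; first exact: differentiable_invmx (dF x Ux) (uF x Ux).
apply: (class_C_ext oU _ (class_C_opp oU (class_C_mulmx oU
  (class_C_mulmx oU CI (DF v)) CI))) => x Ux.
exact/esym/(derive_invmx _ (dF x Ux) (uF x Ux)).
Qed.

Lemma trmx_continuous m n : continuous (@trmx R m n).
Proof.
move=> M; apply/continuous_mx => i j.
rewrite /prop_for /continuous_at mxE; under eq_cvg do rewrite mxE.
exact: coord_continuous.
Qed.

Lemma class_C_trmx m n k (U : set V) (F : V -> 'M[R]_(m, n)) : open U ->
  class_C k U F -> class_C k U (fun x => (F x)^T).
Proof. by move=> oU; apply: class_C_lin => //; exact: trmx_continuous. Qed.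

Lemma differentiable_row_mx m n p (F : V -> 'M[R]_(m, n))
    (G : V -> 'M[R]_(m, p)) x : differentiable F x -> differentiable G x ->
  differentiable (fun x => row_mx (F x) (G x)) x.
Proof.
move=> dF dG.
have -> : (fun x => row_mx (F x) (G x)) =
    (fun x => F x *m row_mx 1%:M 0) + (fun x => G x *m row_mx 0 1%:M).
  apply/funext => y; rewrite -![(_ + _ : _ -> _) _]/(_ + _).
  by rewrite !mul_mx_row !mulmx1 !mulmx0 add_row_mx addr0 add0r.
by apply: differentiableD; apply: differentiable_mulmx => //;
  exact: differentiable_cst.
Qed.

Lemma class_C_row_mx m n p k (U : set V) (F : V -> 'M[R]_(m, n))
    (G : V -> 'M[R]_(m, p)) : open U ->
  class_C k U F -> class_C k U G -> class_C k U (fun x => row_mx (F x) (G x)).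
Proof.
move=> oU CF CG.
apply: class_C_ext (class_C_add oU (class_C_mulr (row_mx 1%:M 0) oU CF)
  (class_C_mulr (row_mx 0 1%:M) oU CG)) => // x _.
by rewrite !mul_mx_row !mulmx1 !mulmx0 add_row_mx addr0 add0r.
Qed.

(** Over the reals v A A^T = 0 forces |v A|^2 = 0. A row-free A thus has the right inverse A^T (A
    A^T)^-1, which depends on A as regularly as products and inverses do. *)
Lemma row_free_mulmx_tr m n (A : 'M[R]_(m, n)) : row_free A ->
  A *m A^T \in unitmx.
Proof.
move=> fA; rewrite -row_free_unit; apply: inj_row_free => v.
rewrite mulmxA => vAA; apply: (row_free_inj fA); rewrite mul0mx.
have : (v *m A) *m (v *m A)^T = 0 by rewrite trmx_mul mulmxA vAA mul0mx.
move: (v *m A) => w /matrixP/(_ 0 0); rewrite !mxE => /eqP.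
rewrite psumr_eq0 => [/allP w0|i _]; last by rewrite mxE -expr2 sqr_ge0.
apply/rowP => i; have := w0 i (mem_index_enum i).
by rewrite !mxE mulf_eq0 orbb => /eqP.
Qed.

Lemma mul_tr_comm n (S : 'M[R]_n) (v w : 'rV[R]_n) : S^T = S ->
  v *m (S *m w^T) = w *m (S *m v^T).
Proof.
move=> sS; rewrite [LHS]mx11_scalar -tr_scalar_mx -mx11_scalar.
by rewrite !trmx_mul trmxK sS mulmxA.
Qed.

(* Regularity half of the implicit function theorem: for [h := u y - u x] the
   equations give [h K(x, y) = - u x (B y - B x)] exactly, where [K(x, y)]
   depends on [u] continuously and is left-cancellable on the diagonal. *)
Lemma class_C_implicit N m k (U : set V) (B : V -> 'M[R]_(N, m))
    (S1 S2 : 'M[R]_N) (c1 c2 : 'M[R]_1) (u : V -> 'rV[R]_N) : open U ->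
  S1^T = S1 -> S2^T = S2 -> class_C k U B -> class_C 0 U u ->
  (forall x, U x -> u x *m B x = 0) ->
  (forall x, U x -> u x *m (S1 *m (u x)^T) = c1) ->
  (forall x, U x -> u x *m (S2 *m (u x)^T) = c2) ->
  (forall x (h : 'rV_N), U x -> h *m B x = 0 -> h *m (S1 *m (u x)^T) = 0 ->
     h *m (S2 *m (u x)^T) = 0 -> h = 0) ->
  class_C k U u.
Proof.
move=> oU sS1 sS2 CB Cu uB uS1 uS2 kerK.
(* Since u S u^T is constant and S symmetric, (u y - u x) S (u x + u y)^T = 0: by polarization the
   quadratic equations become linear in the increment. [E] pads B with zeros to the width of K. *)
pose K x y := row_mx (B y) (row_mx (S1 *m (u x + u y)^T) (S2 *m (u x + u y)^T)).
pose E y : 'M[R]_(N, m + (1 + 1)) := row_mx (B y) 0.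
have diffK x y : U x -> U y -> (u y - u x) *m K x y = - u x *m (E y - E x).
  move=> Ux Uy.
  have quad S c : S^T = S -> u x *m (S *m (u x)^T) = c ->
      u y *m (S *m (u y)^T) = c -> (u y - u x) *m (S *m (u x + u y)^T) = 0.
    move=> sS ex ey; rewrite linearD /= mulmxDr mulmxDr !mulmxBl ex ey.
    by rewrite (mul_tr_comm (u x) (u y) sS) addrA subrK subrr.
  rewrite /E opp_row_mx add_row_mx subrr /K !mul_mx_row.
  rewrite (quad _ _ sS1 (uS1 _ Ux) (uS1 _ Uy)) (quad _ _ sS2 (uS2 _ Ux) (uS2 _ Uy)).
  rewrite row_mx0 mulmx0 mulmxBl mulNmx mulmxBr uB// uB//.
  by rewrite subr0 sub0r.
(* On the diagonal the last two columns are 2 S (u x)^T, so up to the factor 2 this is the kernel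
   hypothesis. *)
have freeK x : U x -> row_free (K x x).
  move=> Ux; apply: inj_row_free => h; rewrite /K !mul_mx_row.
  rewrite -(row_mx0 R 1 m (1 + 1)) => /eq_row_mx[hB].
  rewrite -(row_mx0 R 1 1 1) => /eq_row_mx[h1 h2].
  have half S : h *m (S *m (u x + u x)^T) = 0 -> h *m (S *m (u x)^T) = 0.
    rewrite linearD /= !mulmxDr -mulr2n -scaler_nat => /eqP.
    by rewrite scaler_eq0 pnatr_eq0 => /eqP.
  by apply: (kerK x) => //; exact: half.
have CK l x : class_C l U B -> class_C l U u -> class_C l U (K x).
  move=> CBl Cul; have Cs : class_C l U (fun y => (u x + u y)^T).
    by apply: class_C_trmx => //; apply: class_C_add => //; exact: class_C_cst.
  by do 2?apply: class_C_row_mx => //; exact: class_C_mull.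
have CKd l : class_C l U B -> class_C l U u -> class_C l U (fun x => K x x).
  move=> CBl Cul; have Cs : class_C l U (fun y => (u y + u y)^T).
    by apply: class_C_trmx => //; exact: class_C_add.
  by do 2?apply: class_C_row_mx => //; exact: class_C_mull.
elim: k CB => [//|k IH] CB; have {}IH := IH (class_CS CB).
have CE : class_C k.+1 U E by apply: class_C_row_mx => //; exact: class_C_cst.
have du x : U x -> differentiable u x.
  (* G is invertible at y = x, hence nearby, and K(x,x)^T G^-1 is then a right inverse of K(x,y),
     continuous in y. *)
  move=> Ux; pose G y := K x y *m (K x x)^T.
  have uG : G x \in unitmx by exact/row_free_mulmx_tr/freeK.
  have cG : {for x, continuous G}.
    exact: (class_C_mulr (K x x)^T oU (CK 0%N x (class_C_le (leq0n _) CB) Cu) x Ux).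
  pose F y := - u x *m (E y - E x).
  have dF : differentiable F x.
    apply: differentiable_mulmx; first exact: differentiable_cst.
    apply: (differentiableB (class_C_differentiable (ltn0Sn _) CE Ux)).
    exact: differentiable_cst.
  (* This function is the increment u y - u x. Its factor F is differentiable and vanishes at x, so
     continuity of the right inverse suffices. *)
  have dH : differentiable (fun y => F y *m ((K x x)^T *m invmx (G y))) x.
    apply: (differentiable_mulmx_vanish dF); first by rewrite /F subrr mulmx0.
    apply: continuous_mulmx; first exact: cst_continuous.
    exact: continuous_invmx.
  apply: near_eq_differentiable (differentiableD (differentiable_cst (u x) x) dH).
  near=> y; rewrite -[LHS]/(u x + _).
  have Uy : U y by near: y; exact: (open_nbhs_nbhs (conj oU Ux)).
  have uGy : G y \in unitmx.
    rewrite unitmxE unitfE; near: y.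
    have := continuous_det cG; move/cvgr_neq0; apply.
    by rewrite -unitfE -unitmxE.
  rewrite /F -(diffK x y Ux Uy) -mulmxA (mulmxA (K x y)) -/(G y) mulmxV//.
  by rewrite mulmx1 addrC subrK.
split=> // v.
have [dE DE] := CE.
have CKT := class_C_trmx oU (CKd _ (class_CS CB) IH).
(* The derivative of u is - u (D_v E) K^T (K K^T)^-1, with K taken on the diagonal; every factor is
   already known to be of class C^k. *)
apply: (class_C_ext oU _ (class_C_opp oU (class_C_mulmx oU
  (class_C_mulmx oU (class_C_mulmx oU IH (DE v)) CKT)
  (class_C_invmx oU _ (class_C_mulmx oU (CKd _ (class_CS CB) IH) CKT))))).
  move=> x Ux; have dKx : differentiable (K x) x.
    have dS S : differentiable (fun y => S *m (u x + u y)^T) x.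
      apply: differentiable_mulmx; first exact: differentiable_cst.
      apply: (@differentiable_comp _ _ _ _ (fun y => u x + u y) (@trmx R 1 N)).
        exact: differentiableD (differentiable_cst _ _) (du x Ux).
      by apply: linear_differentiable; exact: trmx_continuous.
    apply: differentiable_row_mx; last exact: differentiable_row_mx.
    exact: class_C_differentiable CB Ux.
  have : 'D_v (fun y => (u y - u x) *m K x y) x
      = 'D_v (fun y => - u x *m (E y - E x)) x.
    apply: near_eq_derive; near=> y; apply: diffK => //.
    by near: y; exact: (open_nbhs_nbhs (conj oU Ux)).
  have subc N' m' (H : V -> 'M[R]_(N', m')) : differentiable H x ->
      differentiable (fun y => H y - H x) x /\
      'D_v (fun y => H y - H x) x = 'D_v H x.
    move=> dH; split; first exact: differentiableB dH (differentiable_cst (H x) x).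
    have := deriveB (@diff_derivable _ _ _ _ _ v dH)
      (@diff_derivable _ _ _ _ _ v (differentiable_cst (H x) x)).
    by rewrite derive_cst subr0.
  have [dux Dux] := subc _ _ _ (du x Ux); have [dEx DEx] := subc _ _ _ (dE x Ux).
  (* At y = x the undifferentiated increments vanish, leaving (D_v u) K(x,x) = - u D_v E; no
     derivative of K survives. *)
  rewrite (derive_mulmx _ dux dKx) (derive_mulmx _ (differentiable_cst _ _) dEx).
  rewrite derive_cst !subrr !mul0mx addr0 add0r Dux DEx.
  move=> e; have {}e : 'D_v u x *m K x x = - u x *m 'D_v E x := e.
  rewrite -!mulNmx -e -(mulmxA _ (K x x)) mulmxK//.
  exact/row_free_mulmx_tr/freeK.
by move=> x Ux; exact/row_free_mulmx_tr/freeK.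
Unshelve. all: by end_near. Qed.

End ClassC.

(** * Bilinear forms and null frames *)

(** Rows are vectors, so one matrix identity treats all partial derivatives of a map at once. *)
Definition gram (R : pzRingType) N m k (S : 'M[R]_N) (X : 'M[R]_(m, N))
  (Y : 'M[R]_(k, N)) : 'M[R]_(m, k) := X *m S *m Y^T.

Section Gram.
Context (R : fieldType) (N : nat) (S : 'M[R]_N).

Lemma gramDl m k (X X' : 'M[R]_(m, N)) (Y : 'M[R]_(k, N)) :
  gram S (X + X') Y = gram S X Y + gram S X' Y.
Proof. by rewrite /gram !mulmxDl. Qed.

Lemma gramDr m k (X : 'M[R]_(m, N)) (Y Y' : 'M[R]_(k, N)) :
  gram S X (Y + Y') = gram S X Y + gram S X Y'.
Proof. by rewrite /gram linearD /= mulmxDr. Qed.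

Lemma gramMl l m k (A : 'M[R]_(l, m)) (X : 'M[R]_(m, N)) (Y : 'M[R]_(k, N)) :
  gram S (A *m X) Y = A *m gram S X Y.
Proof. by rewrite /gram !mulmxA. Qed.

Lemma gramMr l m k (A : 'M[R]_(l, k)) (X : 'M[R]_(m, N)) (Y : 'M[R]_(k, N)) :
  gram S X (A *m Y) = gram S X Y *m A^T.
Proof. by rewrite /gram trmx_mul !mulmxA. Qed.

Lemma gramNl m k (X : 'M[R]_(m, N)) (Y : 'M[R]_(k, N)) :
  gram S (- X) Y = - gram S X Y.
Proof. by rewrite /gram !mulNmx. Qed.

Lemma gramNr m k (X : 'M[R]_(m, N)) (Y : 'M[R]_(k, N)) :
  gram S X (- Y) = - gram S X Y.
Proof. by rewrite /gram linearN /= mulmxN. Qed.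

Lemma gramZl m k a (X : 'M[R]_(m, N)) (Y : 'M[R]_(k, N)) :
  gram S (a *: X) Y = a *: gram S X Y.
Proof. by rewrite /gram -!scalemxAl. Qed.

Lemma gramZr m k a (X : 'M[R]_(m, N)) (Y : 'M[R]_(k, N)) :
  gram S X (a *: Y) = a *: gram S X Y.
Proof. by rewrite /gram linearZ /= -scalemxAr. Qed.

Lemma gram_tr m k (X : 'M[R]_(m, N)) (Y : 'M[R]_(k, N)) :
  (gram S X Y)^T = gram S^T Y X.
Proof. by rewrite /gram !trmx_mul trmxK mulmxA. Qed.

Lemma gram_row m k (X : 'M[R]_(m, N)) (Y : 'M[R]_(k, N)) i j :
  gram S X Y i j = gram S (row i X) (row j Y) 0 0.
Proof.
rewrite /gram -!row_mul !mxE; apply: eq_bigr => l _.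
by rewrite !mxE.
Qed.

Lemma gram_row_free n (D : 'M[R]_(n, N)) : gram S D D \in unitmx -> row_free D.
Proof.
move=> uD; rewrite /row_free eqn_leq rank_leq_row /=.
rewrite -[X in (X <= _)%N](mxrank_unit uD) /gram -mulmxA.
exact: mxrankM_maxl.
Qed.

Lemma gram_neq0 (s : 'rV[R]_N) : gram S s s = 1%:M -> s != 0.
Proof.
move=> ss; apply/eqP => s0; move: ss; rewrite s0 /gram !mul0mx => /esym/eqP.
by rewrite -[1%:M]/(1 : 'M[R]_1) oner_eq0.
Qed.

(* The frame (u, s, D) is linearly independent, so its orthogonal complement
   is a line; it contains s. *)
Lemma null_complement n m (D : 'M[R]_(n, N)) (u s : 'rV[R]_N) (W : 'M[R]_(m, N)) :
  (N <= n.+3)%N -> S \in unitmx -> S^T = S ->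
  gram S u u = 1%:M -> gram S D u = 0 -> gram S D D \in unitmx ->
  gram S s u = 0 -> gram S D s = 0 -> gram S s s = 0 -> s != 0 ->
  gram S W u = 0 -> gram S W D = 0 -> gram S W s = 0 -> (W <= s)%MS.
Proof.
move=> leN uS sS uu Du DD su Ds ss s0 Wu WD Ws.
pose X := col_mx (col_mx u s) D.
have fX : row_free X.
  apply: inj_row_free => v; rewrite -[v]hsubmxK -[lsubmx v]hsubmxK.
  move: (lsubmx (lsubmx v)) (rsubmx (lsubmx v)) (rsubmx v) => a b d.
  rewrite /X !mul_row_col => e.
  (* Pairing the relation with u kills a, and pairing the rest with D kills d; the remaining b s = 0
     has s nonzero. *)
  have a0 : a = 0.
    have : gram S (a *m u + b *m s + d *m D) u = 0 by rewrite e /gram !mul0mx.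
    by rewrite !gramDl !gramMl uu su Du !mulmx0 mulmx1 !addr0.
  move: e; rewrite a0 mul0mx add0r => e.
  have d0 : d = 0.
    have : gram S (b *m s + d *m D) D = 0 by rewrite e /gram !mul0mx.
    rewrite !gramDl !gramMl -[gram S s D]trmxK gram_tr sS Ds trmx0 mulmx0 add0r.
    by move=> /(congr1 (fun x => x *m invmx (gram S D D))); rewrite mulmxK// mul0mx.
  move: e; rewrite d0 mul0mx addr0 [b]mx11_scalar mul_scalar_mx => /eqP.
  rewrite scaler_eq0 (negbTE s0) orbF => /eqP ->.
  by rewrite raddf0 !row_mx0.
have kerP k (Z : 'M[R]_(k, N)) : gram S Z u = 0 -> gram S Z D = 0 ->
    gram S Z s = 0 -> (Z <= kermx (S *m X^T))%MS.
  move=> Zu ZD Zs; apply/sub_kermxP; rewrite mulmxA -/(gram S Z X) /gram /X.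
  rewrite !tr_col_mx !mul_mx_row -!/(gram S _ _) Zu ZD Zs.
  by rewrite !row_mx0.
have sD : gram S s D = 0 by rewrite -[LHS]trmxK gram_tr sS Ds trmx0.
have sker := kerP _ _ su sD ss.
apply: submx_trans (kerP _ _ Wu WD Ws) _.
rewrite -(mxrank_leqif_sup sker).2 eqn_leq mxrankS//=.
(* The frame has n + 2 independent rows in dimension at most n + 3, so its orthogonal complement has
   rank at most 1. *)
have rX : \rank (S *m X^T) = (1 + 1 + n)%N.
  by rewrite -mxrank_tr trmx_mul trmxK sS mxrankMfree ?row_free_unit//; exact/eqP.
by rewrite mxrank_ker rX leq_subLR rank_rV s0 addnC.
Qed.

End Gram.

(** * Traces of resolvents and signature under congruence *)

Section Trace.
Context (R : fieldType) (n : nat).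

(* [\adj (t - A)] has char polys of principal minors on its diagonal *)
Lemma tr_resolvent_poly (A : 'M[R]_n) : n%:R != 0 :> R ->
  exists2 Q : {poly R}, size Q = n &
    forall t : R, t%:M - A \in unitmx ->
      Q.[t] = \det (t%:M - A) * \tr (invmx (t%:M - A)).
Proof.
case: n A => [|m] A n0; first by rewrite eqxx in n0.
exists (\tr (\adj (char_poly_mx A))).
  pose M i : 'M[R]_m := row' i (col' i A).
  have cofE i : (\adj (char_poly_mx A)) i i = char_poly (M i).
    rewrite mxE /cofactor addnn -signr_odd odd_double mul1r; congr (\det _).
    apply/matrixP => k l; rewrite !mxE; congr (_ *+ _ - _).
    by rewrite (inj_eq lift_inj).
  have trE : \tr (\adj (char_poly_mx A)) = \sum_i char_poly (M i).
    by apply: eq_bigr => i _; exact: cofE.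
  (* Each of the m + 1 summands is monic of degree m, so the degree is exactly m as soon as m + 1 is
     nonzero in the field. *)
  have coefm : (\sum_i char_poly (M i))`_m = m.+1%:R.
    rewrite coef_sum (eq_bigr (fun=> 1)) ?sumr_const ?card_ord// => i _.
    by have /monicP := char_poly_monic (M i); rewrite /lead_coef size_char_poly.
  apply/eqP; rewrite eqn_leq trE; apply/andP; split.
    apply: (leq_trans (size_sum _ _ _)); apply/bigmax_leqP => i _.
    by rewrite size_char_poly.
  rewrite ltnNge; apply: contra n0 => /leq_sizeP/(_ m (leqnn _)).
  by rewrite coefm => ->.
move=> t uA; have evalE : map_mx (horner_eval t) (char_poly_mx A) = t%:M - A.
  apply/matrixP => i j; rewrite !mxE /horner_eval.
  by rewrite hornerD hornerN hornerC hornerMn hornerX.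
rewrite -[LHS]/(horner_eval t _) -trace_map_mx map_mx_adj evalE.
by rewrite /invmx uA mxtraceZ mulrA mulfV ?mul1r// -unitfE -unitmxE.
Qed.

(** With X = tau - A and g the metric of sigma, X g X^T is the metric of phi and X g pairs d phi
    with d sigma. The inverse X^-T (X g)^-1, conjugated cyclically under the trace, leaves X^-T. *)
Lemma tr_invmx_congr (X g : 'M[R]_n) : X \in unitmx -> g \in unitmx ->
  \tr (invmx (X *m g *m X^T) *m (X *m g)) = \tr (invmx X).
Proof.
move=> uX ug; have uXg : X *m g \in unitmx by rewrite unitmx_mul uX.
have uXT : X^T \in unitmx by rewrite unitmx_tr.
have -> : invmx (X *m g *m X^T) = invmx X^T *m invmx (X *m g).
  have u : X *m g *m X^T \in unitmx by rewrite unitmx_mul uXg.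
  rewrite -[RHS](mulmxK u) -(mulmxA (invmx X^T)) (mulmxA (invmx (X *m g))).
  by rewrite mulVmx// mul1mx mulVmx// mul1mx.
by rewrite mulmxKV// -trmx_inv mxtrace_tr.
Qed.

End Trace.

Lemma has_signature_congr (R : realType) p q (X g : 'M[R]_(p + q)) :
  X \in unitmx -> has_signature g -> has_signature (X *m g *m X^T).
Proof.
move=> uX [B uB Bg]; exists (B *m invmx X);
  first by rewrite unitmx_mul uB unitmx_inv.
rewrite trmx_mul -Bg !mulmxA mulmxKV// -!mulmxA; congr (_ *m (_ *m _)).
by rewrite mulmxA trmx_inv mulmxV ?mul1mx// unitmx_tr.
Qed.

Lemma has_signature_unit (R : realType) p q (g : 'M[R]_(p + q)) :
  has_signature g -> g \in unitmx.
Proof.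
move=> [B uB Bg].
have : B *m g *m B^T \in unitmx.
  rewrite Bg unitmxE det_lblock det1 mul1r -scaleN1r detZ det1 mulr1.
  by rewrite unitrX// unitrN unitr1.
by rewrite !unitmx_mul => /andP[/andP[]].
Qed.

(** * Differentiation of Gram matrices and of scalar multiples *)

Section GramCalculus.
Context (R : realType) (V : normedModType R).

Lemma differentiable_trmx m n (F : V -> 'M[R]_(m, n)) x :
  differentiable F x -> differentiable (fun y => (F y)^T) x.
Proof.
move=> dF; apply: (@differentiable_comp _ _ _ _ F (@trmx R m n) _ dF).
by apply: linear_differentiable; exact: trmx_continuous.
Qed.

Lemma derive_trmx m n (F : V -> 'M[R]_(m, n)) x v : differentiable F x ->
  'D_v (fun y => (F y)^T) x = ('D_v F x)^T.
Proof.
move=> dF; have dT := differentiable_trmx dF.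
rewrite (deriveE _ dT) (deriveE _ dF).
have dt : differentiable (@trmx R m n) (F x).
  by apply: linear_differentiable; exact: trmx_continuous.
have -> : 'd (fun y => (F y)^T) x = 'd (@trmx R m n) (F x) \o 'd F x :> (V -> _).
  exact: (diff_comp dF dt).
by rewrite /= diff_lin//; exact: trmx_continuous.
Qed.

Lemma derive_gram m n N (S : 'M[R]_N) (F : V -> 'M[R]_(m, N))
    (G : V -> 'M[R]_(n, N)) x v : differentiable F x -> differentiable G x ->
  'D_v (fun y => gram S (F y) (G y)) x =
  gram S ('D_v F x) (G x) + gram S (F x) ('D_v G x).
Proof.
move=> dF dG; rewrite /gram.
have dS := differentiable_mulmx dF (differentiable_cst S x).
rewrite (derive_mulmx v dS (differentiable_trmx dG)) derive_trmx//.
rewrite (derive_mulmx v dF (differentiable_cst S x)) derive_cst.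
by rewrite mulmx0 addr0.
Qed.

Lemma class_C_gram m n N k (U : set V) (S : 'M[R]_N) (F : V -> 'M[R]_(m, N))
    (G : V -> 'M[R]_(n, N)) : open U ->
  class_C k U F -> class_C k U G -> class_C k U (fun y => gram S (F y) (G y)).
Proof.
move=> oU CF CG; apply: class_C_mulmx => //; first exact: class_C_mulr.
exact: class_C_trmx.
Qed.

Lemma derive_scalel (W : normedModType R) (t : V -> R^o) (w : W) x v :
  differentiable t x -> 'D_v (fun y => (t y : R) *: w) x = ('D_v t x : R) *: w.
Proof.
move=> dt; rewrite (deriveE _ (differentiableZl w dt)) (deriveE _ dt).
by rewrite diffZl.
Qed.

(** Taken at [w = 1%:M], it turns a scalar function into a 1 by 1 matrix, which brings products tau
    sigma under [class_C_mulmx]. *)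
Lemma class_C_scalel (W : normedModType R) k (U : set V) (t : V -> R^o) (w : W) :
  open U -> class_C k U t -> class_C k U (fun y => (t y : R) *: w).
Proof.
move=> oU; elim: k t => [|k IH] t.
  by move=> ct x Ux; apply: cvgZr_tmp; exact: ct.
move=> [dt Dt]; split=> [x Ux|v]; first exact: differentiableZl (dt x Ux).
apply: (class_C_ext oU _ (IH _ (Dt v))) => x Ux.
exact/esym/derive_scalel/dt.
Qed.

Lemma class_C_coord k (U : set V) m n (F : V -> 'M[R]_(m, n)) i j : open U ->
  class_C k U F -> class_C k U (fun y => F y i j : R^o).
Proof.
move=> oU; elim: k F => [|k IH] F.
  by move=> cF x Ux; have /continuous_mx := cF x Ux; exact.
move=> [dF DF]; split=> [x Ux|v].
  by have /differentiable_mx := dF x Ux; exact.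
apply: (class_C_ext oU _ (IH _ (DF v))) => x Ux.
exact/derive_coord/dF.
Qed.

End GramCalculus.

(** [class_C] speaks of directional derivatives only, so the Jacobian is rebuilt from its rows, the
    derivatives along the basis vectors. *)
Lemma class_C_jacobian (R : realType) n N k (U : set 'rV[R]_n)
    (F : 'rV[R]_n -> 'rV[R]_N) : open U ->
  class_C k.+1 U F -> class_C k U (fun y => 'J F y).
Proof.
move=> oU [dF DF].
have Csum (r : seq 'I_n) : class_C k U (fun y =>
    \sum_(i <- r) delta_mx i (0 : 'I_1) *m 'D_(delta_mx 0 i) F y).
  elim: r => [|i r IH].
    by under eq_fun do rewrite big_nil; exact: class_C_cst.
  under eq_fun do rewrite big_cons.
  by apply: class_C_add => //; apply: class_C_mull => //; exact: DF.
apply: (class_C_ext oU _ (Csum (index_enum 'I_n))) => x Ux /=.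
under eq_bigr => i _ do rewrite (deriveEjacobian _ (dF x Ux)) mulmxA mul_delta_mx.
rewrite -mulmx_suml -[RHS]mul1mx; congr (_ *m _).
apply/matrixP => i j; rewrite summxE !mxE (bigD1 i)//= mxE eqxx/= big1 ?addr0//.
  by rewrite eq_sym.
by move=> l li; rewrite mxE eq_sym (negbTE li).
Qed.

(* Locked: conversion between the differentials of two different maps unfolds
   ['d] and does not terminate in practice. *)
HB.lock Definition jacL (R : realType) (n k : nat) (M : manifold R n k) (N : nat)
  (c : chart R n M) (f : M -> 'rV[R]_N) (x : M) : 'M[R]_(n, N) := jac c f x.

Lemma jacLE (R : realType) (n k : nat) (M : manifold R n k) (N : nat)
  (c : chart R n M) (f : M -> 'rV[R]_N) (x : M) : jac c f x = jacL c f x.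
Proof. by rewrite jacL.unlock. Qed.

(** * The ambient bilinear forms as matrices *)

Section AmbientForms.
Context (R : realType) (a b : nat).
Local Notation E := 'rV[R]_(a + b).

(** The Euclidean products of the two factors are kept apart, since lying on or being tangent to
    both spheres is not expressible by their difference alone. *)
Definition lform : 'M[R]_(a + b) := block_mx 1%:M 0 0 0.
Definition rform : 'M[R]_(a + b) := block_mx 0 0 0 1%:M.
Definition ipform : 'M[R]_(a + b) := lform - rform.

Lemma dotE m (u v : 'rV[R]_m) : u *m v^T = (dot u v)%:M.
Proof.
rewrite [LHS]mx11_scalar mxE; congr (_%:M).
by apply: eq_bigr => i _; rewrite mxE.
Qed.

Lemma lformE (u v : E) : gram lform u v = (dot (lsubmx u) (lsubmx v))%:M.
Proof.
rewrite -dotE /gram -{1}[u]hsubmxK -{1}[v]hsubmxK mul_row_block.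
by rewrite !mulmx0 !mulmx1 !addr0 tr_row_mx mul_row_col mul0mx addr0.
Qed.

Lemma rformE (u v : E) : gram rform u v = (dot (rsubmx u) (rsubmx v))%:M.
Proof.
rewrite -dotE /gram -{1}[u]hsubmxK -{1}[v]hsubmxK mul_row_block.
by rewrite !mulmx0 !mulmx1 !add0r tr_row_mx mul_row_col mul0mx add0r.
Qed.

Lemma gramB m k (X : 'M[R]_(m, a + b)) (Y : 'M[R]_(k, a + b)) :
  gram ipform X Y = gram lform X Y - gram rform X Y.
Proof. by rewrite /gram /ipform mulmxBr mulmxBl. Qed.

Lemma ipE (u v : E) : gram ipform u v = (ip u v)%:M.
Proof. by rewrite gramB lformE rformE -raddfB. Qed.

Lemma lform_sym : lform^T = lform.
Proof. by rewrite tr_block_mx !trmx0 trmx1. Qed.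

Lemma rform_sym : rform^T = rform.
Proof. by rewrite tr_block_mx !trmx0 trmx1. Qed.

Lemma ipform_sym : ipform^T = ipform.
Proof. by rewrite linearB /= lform_sym rform_sym. Qed.

Lemma ipform_unit : ipform \in unitmx.
Proof.
have : ipform *m ipform = 1%:M.
  rewrite /ipform opp_block_mx add_block_mx !oppr0 !addr0 add0r mulmx_block.
  rewrite !mulmx0 !mul0mx !addr0 !add0r mulmx1 mulNmx mul1mx opprK.
  by rewrite -scalar_mx_block.
by case/mulmx1_unit.
Qed.

Lemma scalar_mx1_inj (x y : R) : x%:M = y%:M :> 'M[R]_1 -> x = y.
Proof. by move/matrixP/(_ 0 0); rewrite !mxE eqxx !mulr1n. Qed.

Lemma tangentP (u v : E) : tangent_sphere_product u v <->
  gram lform u v = 0 /\ gram rform u v = 0.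
Proof.
rewrite lformE rformE /tangent_sphere_product.
split=> [[-> ->]|[h1 h2]]; first by rewrite raddf0.
by split; apply: scalar_mx1_inj; rewrite raddf0.
Qed.

Lemma sphere_productP (u : E) : in_sphere_product u <->
  gram lform u u = 1%:M /\ gram rform u u = 1%:M.
Proof.
rewrite lformE rformE /in_sphere_product.
split=> [[-> ->]|[h1 h2]]; first by [].
by split; exact: scalar_mx1_inj.
Qed.

Section Immersed.
Context (n k : nat) (M : manifold R n k).
Implicit Types (c : chart R n M) (f : M -> E) (x : M).

Lemma metricE c f x :
  metric c f x = gram ipform (jacL c f x) (jacL c f x).
Proof.
by apply/matrixP => i j; rewrite gram_row ipE !mxE eqxx mulr1n -!jacLE.
Qed.

Lemma tan_coordE c f x (v : E) :
  tan_coord c f x v = gram ipform v (jacL c f x) *m invmx (metric c f x).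
Proof.
congr (_ *m _); apply/rowP => j; rewrite [RHS]gram_row -jacLE.
by rewrite ipE !mxE eqxx mulr1n; congr (ip _ _); apply/rowP => l; rewrite mxE.
Qed.

Lemma shape_operatorE c (sigma nu : M -> E) x : shape_operator c sigma nu x =
  - (gram ipform (jacL c nu x) (jacL c sigma x) *m invmx (metric c sigma x)).
Proof.
congr (- _); apply/row_matrixP => i; rewrite rowK tan_coordE row_mul.
by congr (_ *m _); rewrite /gram !row_mul -!jacLE.
Qed.

End Immersed.
End AmbientForms.

(** * Differentials in a chart *)

Section Charts.
Context (R : realType) (n k : nat) (M : manifold R n k).
Implicit Types (c : chart R n M) (x : M).

Lemma chart_nbhs c x : chart_dom c x ->
  \forall y \near chart_map c x, chart_im c y.
Proof.
move=> cx; apply: open_nbhs_nbhs; split; first exact: chart_im_open.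
exact: chart_map_im.
Qed.

Lemma of_class_le l m (W : normedModType R) (f : M -> W) :
  (l <= m)%N -> of_class m f -> of_class l f.
Proof. by move=> lm Cf c ac; exact: class_C_le lm (Cf c ac). Qed.

Lemma of_class_continuous m (W : normedModType R) (f : M -> W) :
  of_class m f -> continuous f.
Proof.
move=> Cf x; have [c ac cx] := atlas_cover x.
have cy := chart_map_im cx.
have cfi : {for chart_map c x, continuous (f \o chart_inv c)}.
  exact: (class_C_le (leq0n m) (Cf c ac)) cy.
have cm := chart_map_cont cx.
have : ((f \o chart_inv c) \o chart_map c) @ x --> f x.
  by rewrite -[X in _ --> f X](chart_mapK cx); exact: continuous_comp cm cfi.
apply: cvg_trans.
apply: near_eq_cvg; have := open_nbhs_nbhs (conj (chart_dom_open c) cx).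
by apply: filterS => z cz; rewrite /= chart_mapK.
Qed.

Lemma row_jac N c (f : M -> 'rV[R]_N) x i :
  differentiable (f \o chart_inv c) (chart_map c x) ->
  row i (jacL c f x) = 'D_(delta_mx 0 i) (f \o chart_inv c) (chart_map c x).
Proof. by move=> df; rewrite -jacLE rowE deriveEjacobian. Qed.

(** Leibniz rule for a constant product, one row per coordinate. A 1 by 1 matrix equals its
    transpose, which moves f to the right-hand slot and transposes S. *)
Lemma gram_jac N (S : 'M[R]_N) w0 c x (f g : M -> 'rV[R]_N) : chart_dom c x ->
  differentiable (f \o chart_inv c) (chart_map c x) ->
  differentiable (g \o chart_inv c) (chart_map c x) ->
  (forall z, gram S (f z) (g z) = w0) ->
  gram S (jacL c f x) (g x) + gram S^T (jacL c g x) (f x) = 0.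
Proof.
move=> cx df dg fg; apply/row_matrixP => i.
rewrite linearD /= row0 /gram !row_mul -!/(gram _ _ _) (row_jac i df) (row_jac i dg).
have := derive_gram S (delta_mx 0 i) df dg.
rewrite /= (_ : (fun y => _) = fun=> w0) ?derive_cst; last first.
  by apply/funext => y; exact: fg.
rewrite chart_mapK// => /esym e; rewrite -[RHS]e; congr (_ + _).
by rewrite [LHS]mx11_scalar -tr_scalar_mx -mx11_scalar gram_tr trmxK.
Qed.

(** Differentiate <d_j f, s> = 0 in direction i: a second derivative of f is traded for a first
    derivative of the normal field s. *)
Lemma gram_partial2 N (S : 'M[R]_N) c x (f s : M -> 'rV[R]_N) i j :
  chart_dom c x -> class_C 2 (chart_im c) (f \o chart_inv c) ->
  differentiable (s \o chart_inv c) (chart_map c x) ->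
  (forall z, chart_dom c z -> gram S (jacL c f z) (s z) = 0) ->
  gram S (partial2 c f x i j) (s x) =
  - gram S (row j (jacL c f x)) (row i (jacL c s x)).
Proof.
move=> cx Cf ds fs; have cy := chart_map_im cx.
have [df [ddf _]] := (Cf.1, Cf.2 (delta_mx 0 j)).
have := derive_gram S (delta_mx 0 i) (ddf _ cy) ds.
have -> : 'D_(delta_mx 0 i) (fun y => gram S ('D_(delta_mx 0 j)
    (f \o chart_inv c) y) ((s \o chart_inv c) y)) (chart_map c x) = 0.
  rewrite -[RHS](derive_cst (0 : 'M[R]_1) (chart_map c x) (delta_mx 0 i)).
  apply: near_eq_derive; apply: filterS (chart_nbhs cx) => y yc.
  have /(congr1 (row j)) := fs _ (chart_inv_dom yc).
  rewrite /gram !row_mul row0 -/(gram _ _ _) row_jac ?chart_invK//; exact: df.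
move=> /esym/eqP; rewrite addr_eq0 /partial2 => /eqP.
by rewrite /= chart_mapK// => ->; rewrite -(row_jac j (df _ cy)) -(row_jac i ds).
Qed.

(** The column v holds the partial derivatives of tau. It is left abstract because later
    computations work modulo sigma. *)
Lemma jac_phi_of a b c x (sigma nu : M -> 'rV[R]_(a + b)) (tau : M -> R^o) :
  chart_dom c x ->
  differentiable (sigma \o chart_inv c) (chart_map c x) ->
  differentiable (nu \o chart_inv c) (chart_map c x) ->
  differentiable (tau \o chart_inv c) (chart_map c x) ->
  differentiable (phi_of sigma nu tau \o chart_inv c) (chart_map c x) /\
  exists v : 'cV[R]_n, jacL c (phi_of sigma nu tau) x =
    jacL c nu x + (tau x : R) *: jacL c sigma x + v *m sigma x.
Proof.
move=> cx ds dn dt.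
set t := tau \o _ in dt; set s := sigma \o _ in ds; set u := nu \o _ in dn.
have dT : differentiable (fun y => (t y : R) *: (1%:M : 'M[R]_1)) (chart_map c x).
  exact: differentiableZl.
have phiE : phi_of sigma nu tau \o chart_inv c =
    u + (fun y => ((t y : R) *: 1%:M) *m s y).
  apply/funext => y; rewrite -![(_ + _ : _ -> _) _]/(_ + _) /= /phi_of /t /s /u /=.
  by rewrite -scalemxAl mul1mx.
have dm := differentiable_mulmx dT ds.
have dphi : differentiable (phi_of sigma nu tau \o chart_inv c) (chart_map c x).
  by rewrite phiE; exact: (differentiableD dn dm).
split; first exact: dphi.
exists (\col_i ('D_(delta_mx 0 i) t (chart_map c x) : R)).
apply/row_matrixP => i; rewrite (row_jac i dphi) phiE.
rewrite (deriveD (diff_derivable dn) (diff_derivable dm)).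
rewrite (derive_mulmx _ dT ds) (derive_scalel _ _ dt) !linearD /= linearZ /=.
rewrite (row_jac i ds) (row_jac i dn) row_mul.
rewrite -/s -/u -addrA; congr (_ + _); rewrite addrC; congr (_ + _).
  rewrite /s /= chart_mapK//; congr (_ *m _).
  by apply/matrixP => l m; rewrite !mxE !ord1 eqxx mulr1.
by rewrite -scalemxAl mul1mx /t /= chart_mapK.
Qed.

End Charts.

(** * Linear algebra of a null frame *)

Section Algebra.
Context (R : fieldType) (N : nat) (J : 'M[R]_N).
Context (uJ : J \in unitmx) (sJ : J^T = J).

Lemma gram_sym0 m k (X : 'M[R]_(m, N)) (Y : 'M[R]_(k, N)) :
  gram J X Y = 0 -> gram J Y X = 0.
Proof. by move=> XY; rewrite -[LHS]trmxK gram_tr sJ XY trmx0. Qed.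

(** T minus its projection on the span of S is orthogonal to u, S and s, so its rows lie on the null
    line of s. It is applied to S = d sigma, T = d nu, and in the converse to S = d f, T = d gam. *)
Lemma weingarten n (S T : 'M[R]_(n, N)) (s u : 'rV[R]_N) :
  (N <= n.+3)%N -> gram J u u = 1%:M -> gram J s s = 0 -> s != 0 ->
  gram J s u = 0 -> gram J S u = 0 -> gram J S s = 0 ->
  gram J S S \in unitmx -> gram J T u = 0 -> gram J T s = 0 ->
  exists v : 'cV[R]_n, T = gram J T S *m invmx (gram J S S) *m S + v *m s.
Proof.
move=> leN uu ss s0 su Su Ss SS Tu Ts.
have /submxP[v Tv] : (T - gram J T S *m invmx (gram J S S) *m S <= s)%MS.
  apply: (null_complement leN uJ sJ uu Su SS su Ss ss s0).
  - by rewrite gramDl gramNl gramMl Tu Su mulmx0 subr0.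
  - by rewrite gramDl gramNl gramMl mulmxKV// subrr.
  - by rewrite gramDl gramNl gramMl Ts Ss mulmx0 subr0.
by exists v; rewrite -Tv addrC subrK.
Qed.

(** The term v s drops out of every product, s being null and orthogonal to S. *)
Lemma gram_phi n (S D : 'M[R]_(n, N)) (X : 'M[R]_n) (v : 'cV[R]_n) (s : 'rV[R]_N) :
  gram J s s = 0 -> gram J S s = 0 -> D = X *m S + v *m s ->
  [/\ gram J D D = X *m gram J S S *m X^T, gram J D S = X *m gram J S S &
      gram J D s = 0].
Proof.
move=> ss Ss ->; have sS := gram_sym0 Ss.
rewrite !gramDl !gramDr !gramMl !gramMr ss Ss sS.
by rewrite !mul0mx !mulmx0 !addr0 mulmxA.
Qed.

(* [h] lies on the null line of [s], on which the form [Sl] is definite. *)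
Lemma null_frame_kernel n (D : 'M[R]_(n, N)) (Sl : 'M[R]_N) (u s h : 'rV[R]_N) :
  (N <= n.+3)%N -> gram J u u = 1%:M -> gram J D u = 0 ->
  gram J D D \in unitmx -> gram J s u = 0 -> gram J D s = 0 ->
  gram J s s = 0 -> gram Sl s s = 1%:M ->
  gram J h u = 0 -> gram J h D = 0 -> gram J h s = 0 -> gram Sl h s = 0 ->
  h = 0.
Proof.
move=> leN uu Du DD su Ds ss sls hu hD hs hls.
have /submxP[v hv] := null_complement leN uJ sJ uu Du DD su Ds ss (gram_neq0 sls)
  hu hD hs.
by move: hls; rewrite hv gramMl sls mulmx1 => ->; rewrite mul0mx.
Qed.

Lemma gram_suml (I : Type) (r : seq I) m k (F : I -> 'M[R]_(m, N))
    (Y : 'M[R]_(k, N)) :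
  gram J (\sum_(i <- r) F i) Y = \sum_(i <- r) gram J (F i) Y.
Proof. by rewrite /gram !mulmx_suml. Qed.

End Algebra.

(** * Second fundamental form and mean curvature *)

Section Curvature.
Context (R : realType) (a b n k : nat) (M : manifold R n k).
Local Notation J := (ipform R a b).
Implicit Types (c : chart R n M) (f s : M -> 'rV[R]_(a + b)) (x : M).

(** Against a normal field s orthogonal to f, the two corrections in [second_form] vanish;
    [gram_partial2] rewrites the rest, and contraction with the inverse metric is a trace. *)
Lemma gram_mean_curvature c f s x : chart_dom c x ->
  class_C 2 (chart_im c) (f \o chart_inv c) ->
  differentiable (s \o chart_inv c) (chart_map c x) ->
  (forall z, chart_dom c z -> gram J (jacL c f z) (s z) = 0) ->
  gram J (f x) (s x) = 0 ->
  gram J (mean_curvature c f x) (s x) =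
  - (n%:R^-1 *
     \tr (invmx (metric c f x) *m gram J (jacL c f x) (jacL c s x)))%:M.
Proof.
move=> cx Cf ds Ds fs.
rewrite /mean_curvature gramZl gram_suml -scale_scalar_mx -scalerN; congr (_ *: _).
rewrite /mxtrace raddf_sum -sumrN; apply: eq_bigr => i _.
rewrite gram_suml mxE raddf_sum -sumrN; apply: eq_bigr => j _.
rewrite gramZl /second_form !gramDl !gramNl gramZl fs scaler0 subr0.
rewrite /tan_proj jacLE gramMl Ds// mulmx0 subr0 (gram_partial2 _ _ cx Cf ds Ds).
by rewrite scalerN gram_row [X in _ *: X]mx11_scalar scale_scalar_mx.
Qed.

(** Supplies two of the three orthogonality relations that put the mean curvature on the null line
    of sigma. *)
Lemma mean_curvature_normal c f x : metric c f x \in unitmx ->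
  gram J (f x) (f x) = 1%:M -> gram J (jacL c f x) (f x) = 0 ->
  gram J (mean_curvature c f x) (f x) = 0 /\
  gram J (mean_curvature c f x) (jacL c f x) = 0.
Proof.
move=> uG ff Df; have fD := gram_sym0 (ipform_sym _ _ _) Df.
have second i j : gram J (second_form c f x i j) (f x) = 0 /\
    gram J (second_form c f x i j) (jacL c f x) = 0.
  rewrite /second_form /tan_proj jacLE tan_coordE !gramDl !gramNl !gramZl !gramMl.
  rewrite Df fD ff -metricE mulmxKV// mulmx0 scaler0 !subr0 subrr.
  by rewrite ipE scale_scalar_mx mulr1 subrr.
rewrite /mean_curvature !gramZl !gram_suml.
split; rewrite big1 ?scaler0// => i _; rewrite gram_suml big1// => j _;
  by rewrite gramZl; have [e1 e2] := second i j; rewrite ?e1 ?e2 scaler0.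
Qed.

Lemma rank_jac c f x : metric c f x \in unitmx -> \rank (jac c f x) = n.
Proof. by rewrite metricE jacLE => /gram_row_free/eqP. Qed.

End Curvature.

(** * From hypersurfaces to marginally trapped submanifolds *)

(** Pointwise model of the hypersurface: [s] and [u] stand for sigma and nu, [S] and [T] for their
    differentials. *)
Record adapted_frame (R : fieldType) (N n : nat) (J : 'M[R]_N)
    (S T : 'M[R]_(n, N)) (s u : 'rV[R]_N) : Prop := AdaptedFrame {
  frame_ss : gram J s s = 0;
  frame_s0 : s != 0;
  frame_su : gram J s u = 0;
  frame_uu : gram J u u = 1%:M;
  frame_Ss : gram J S s = 0;
  frame_Su : gram J S u = 0;
  frame_SS : gram J S S \in unitmx;
  frame_Ts : gram J T s = 0;
  frame_Tu : gram J T u = 0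
}.

Section Correspondence.
Context (R : realType) (p q k : nat) (M : manifold R (p + q) k).
Local Notation N := (p.+2 + q.+1)%N.
Local Notation J := (ipform R p.+2 q.+1).
Local Notation Jl := (lform R p.+2 q.+1).
Local Notation Jr := (rform R p.+2 q.+1).
Implicit Types (c : chart R (p + q) M) (x : M) (sigma nu f g : M -> 'rV[R]_N).

Let leN : (N <= (p + q).+3)%N.
Proof. by rewrite !addSn addnS. Qed.

Let symJ : J^T = J.
Proof. exact: ipform_sym. Qed.

Let unitJ : J \in unitmx.
Proof. exact: ipform_unit. Qed.

Lemma gram_jac_self (S : 'M[R]_N) w c x f : S^T = S -> chart_dom c x ->
  differentiable (f \o chart_inv c) (chart_map c x) ->
  (forall z, gram S (f z) (f z) = w) -> gram S (jacL c f x) (f x) = 0.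
Proof.
move=> sS cx df ff; have := gram_jac cx df df ff.
rewrite sS -mulr2n -scaler_nat => /eqP.
by rewrite scaler_eq0 pnatr_eq0 => /eqP.
Qed.

Lemma gram_jac_sym w c x f g : chart_dom c x ->
  differentiable (f \o chart_inv c) (chart_map c x) ->
  differentiable (g \o chart_inv c) (chart_map c x) ->
  (forall z, gram J (f z) (g z) = w) -> gram J (jacL c g x) (f x) = 0 ->
  gram J (jacL c f x) (g x) = 0.
Proof.
move=> cx df dg fg gf; have := gram_jac cx df dg fg.
by rewrite symJ gf addr0.
Qed.

Lemma row_gram0 m (X : 'M[R]_(m, N)) (v : 'rV[R]_N) :
  (forall i, ip (row i X) v = 0) -> gram J X v = 0.
Proof.
move=> Xv; apply/row_matrixP => i.
by rewrite /gram !row_mul -/(gram _ _ _) ipE Xv raddf0 row0.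
Qed.

(* [T = 0] stands in for [d nu] as long as [nu] is not known to be
   differentiable. *)
Lemma hypersurface_frame sigma nu c x : oriented_hypersurface sigma nu ->
  atlas M c -> chart_dom c x ->
  [/\ gram Jl (sigma x) (sigma x) = 1%:M,
      gram Jl (nu x) (sigma x) = 0, gram Jr (nu x) (sigma x) = 0 &
  (differentiable (nu \o chart_inv c) (chart_map c x) ->
     adapted_frame J (jacL c sigma x) (jacL c nu x) (sigma x) (nu x)) /\
  adapted_frame J (jacL c sigma x) 0 (sigma x) (nu x)].
Proof.
move=> [[Cs _] ss sg [_ gm]] ac cx.
have ds := class_C_differentiable (ltn0Sn _) (Cs c ac) (chart_map_im cx).
have [/sphere_productP[sl sr] [/tangentP[tl tr] uu Su]] := (ss x, gm x).
have sl' : gram Jl (nu x) (sigma x) = 0.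
  by rewrite -[LHS]trmxK gram_tr lform_sym tl trmx0.
have sr' : gram Jr (nu x) (sigma x) = 0.
  by rewrite -[LHS]trmxK gram_tr rform_sym tr trmx0.
have s_s z : gram J (sigma z) (sigma z) = 0.
  by have /sphere_productP[h1 h2] := ss z; rewrite gramB h1 h2 subrr.
have s_u z : gram J (sigma z) (nu z) = 0.
  by have [/tangentP[h1 h2] _ _] := gm z; rewrite gramB h1 h2 subrr.
have u_u z : gram J (nu z) (nu z) = 1%:M by have [_ h _] := gm z; rewrite ipE h.
have S_u : gram J (jacL c sigma x) (nu x) = 0.
  by apply: row_gram0 => i; rewrite -jacLE; exact: Su.
have S_s := gram_jac_self symJ cx ds s_s.
have SS : gram J (jacL c sigma x) (jacL c sigma x) \in unitmx.
  by rewrite -metricE; exact/has_signature_unit/sg.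
have s0 := gram_neq0 sl.
split=> //; split=> [du|]; split=> //; rewrite ?/gram ?mul0mx// -/(gram _ _ _).
  apply: (gram_jac_sym (w := 0) cx du ds _ S_u) => z; exact (gram_sym0 symJ (s_u z)).
exact: gram_jac_self symJ cx du u_u.
Qed.

(** Locally nu is determined by its orthogonality to sigma in each factor and to d sigma, and by
    <nu, nu> = 1. The coefficients contain d sigma, whence the loss of one derivative from C^4. *)
Lemma gauss_map_of_class sigma nu : oriented_hypersurface sigma nu ->
  of_class 3 nu.
Proof.
move=> hyp c ac; have [[Cs _] _ _ [cnu gm]] := hyp.
have {}Cs := Cs c ac; have oU := @chart_im_open _ _ _ c.
pose s := sigma \o chart_inv c.
pose B y := row_mx (row_mx (Jl *m (s y)^T) (Jr *m (s y)^T)) (J *m ('J s y)^T).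
have jacE y : chart_im c y -> 'J s y = jacL c sigma (chart_inv c y).
  by move=> Uy; rewrite -jacLE /jac chart_invK.
(* There is a single quadratic equation here; the second slot is filled by the zero form with value
   0. *)
apply: (@class_C_implicit _ _ _ _ _ _ B J 0 1%:M 0) => //.
- exact: trmx0.
- have CsT := class_C_trmx oU (class_CS Cs).
  apply: (class_C_row_mx oU).
    by apply: (class_C_row_mx oU); exact: class_C_mull.
  by apply: (class_C_mull _ oU); apply: (class_C_trmx oU); exact: class_C_jacobian.
- by move=> y Uy; apply: continuous_comp; [exact: chart_inv_cont|exact: cnu].
- move=> y Uy; have cy := chart_inv_dom Uy.
  have [_ nl nr [_ fr]] := hypersurface_frame hyp ac cy.
  rewrite /B !mul_mx_row !mulmxA -!/(gram _ _ _) /s /= nl nr jacE//.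
  by rewrite (gram_sym0 symJ (frame_Su fr)) !row_mx0.
- move=> y Uy; have cy := chart_inv_dom Uy.
  have [_ _ _ [_ fr]] := hypersurface_frame hyp ac cy.
  by rewrite mulmxA -/(gram _ _ _); exact: frame_uu fr.
- by move=> y Uy; rewrite mul0mx mulmx0.
- move=> y h Uy; have cy := chart_inv_dom Uy.
  have [sl _ _ [_ fr]] := hypersurface_frame hyp ac cy.
  rewrite /B !mul_mx_row !mulmxA -!/(gram _ _ _) /s /= jacE//.
  rewrite -(row_mx0 R 1 (1 + 1) (p + q)) => /eq_row_mx[].
  rewrite -(row_mx0 R 1 1 1) => /eq_row_mx[hl hr] hD hu _.
  have [ss _ su uu Ss Su SS _ _] := fr.
  apply: (null_frame_kernel unitJ symJ leN uu Su SS su Ss ss sl hu hD _ hl).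
  by rewrite gramB hl hr subrr.
Qed.

Lemma jac_phi_frame sigma nu (tau : M -> R^o) c x : chart_dom c x ->
  differentiable (sigma \o chart_inv c) (chart_map c x) ->
  differentiable (nu \o chart_inv c) (chart_map c x) ->
  differentiable (tau \o chart_inv c) (chart_map c x) ->
  adapted_frame J (jacL c sigma x) (jacL c nu x) (sigma x) (nu x) ->
  exists v : 'cV[R]_(p + q), jacL c (phi_of sigma nu tau) x =
    ((tau x)%:M - shape_operator c sigma nu x) *m jacL c sigma x + v *m sigma x.
Proof.
move=> cx ds dn dt [ss s0 su uu Ss Su SS Ts Tu].
have [_ [v ->]] := jac_phi_of cx ds dn dt.
have [w Tw] := weingarten unitJ symJ leN uu ss s0 su
  Su Ss SS Tu Ts.
exists (v + w); rewrite shape_operatorE metricE opprK !mulmxDl mul_scalar_mx.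
move: (gram J (jacL c nu x) (jacL c sigma x) *m invmx _ *m jacL c sigma x) Tw
  => X ->.
by rewrite (addrC (v *m sigma x)) addrA; congr (_ + _); rewrite addrAC (addrC X).
Qed.

(** Shared by both directions: a root makes the mean curvature orthogonal to sigma, and conversely
    that orthogonality gives P(tau) = 0. *)
Lemma mean_curvature_phi sigma nu (tau : M -> R^o) c x :
  of_class 1 sigma -> of_class 1 nu -> of_class 1 tau ->
  of_class 2 (phi_of sigma nu tau) ->
  (forall z, chart_dom c z ->
     adapted_frame J (jacL c sigma z) (jacL c nu z) (sigma z) (nu z)) ->
  atlas M c -> chart_dom c x ->
  let X := (tau x)%:M - shape_operator c sigma nu x in
  let f := phi_of sigma nu tau in
  [/\ metric c f x = X *m metric c sigma x *m X^T,
      gram J (jacL c f x) (sigma x) = 0 &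
      X \in unitmx ->
      gram J (mean_curvature c f x) (sigma x) =
      - ((p + q)%:R^-1 * P_of (shape_operator c sigma nu x) (tau x))%:M].
Proof.
move=> Cs Cn Ct Cf fr ac cx X f.
(* The formula is needed at every z of the chart, because <d phi, sigma> = 0 is going to be
   differentiated. *)
have D z : chart_dom c z -> exists v : 'cV[R]_(p + q), jacL c f z =
    ((tau z)%:M - shape_operator c sigma nu z) *m jacL c sigma z + v *m sigma z.
  move=> cz; have cy := chart_map_im cz; apply: (jac_phi_frame cz _ _ _ (fr z cz)).
  - exact: class_C_differentiable (Cs c ac) cy.
  - exact: class_C_differentiable (Cn c ac) cy.
  - exact: class_C_differentiable (Ct c ac) cy.
have Ds z : chart_dom c z -> gram J (jacL c f z) (sigma z) = 0.
  move=> cz; have [v Dv] := D z cz.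
  by have [] := gram_phi symJ (frame_ss (fr z cz)) (frame_Ss (fr z cz)) Dv.
have [v Dv] := D x cx; have frx := fr x cx.
have [DD DS _] := gram_phi symJ (frame_ss frx) (frame_Ss frx) Dv.
split; [by rewrite !metricE DD|exact: Ds|move=> uX].
have ds : differentiable (sigma \o chart_inv c) (chart_map c x).
  exact: class_C_differentiable (Cs c ac) (chart_map_im cx).
have fs : gram J (f x) (sigma x) = 0.
  rewrite /f /phi_of gramDl gramZl (frame_ss frx) (gram_sym0 symJ (frame_su frx)).
  by rewrite scaler0 addr0.
rewrite (gram_mean_curvature cx (Cf c ac) ds Ds fs) metricE DD DS.
by rewrite tr_invmx_congr//; exact: frame_SS frx.
Qed.

Lemma phi_marginally_trapped sigma nu (tau : M -> R^o) :
  oriented_hypersurface sigma nu -> is_root sigma nu tau ->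
  marginally_trapped (phi_of sigma nu tau).
Proof.
move=> hyp [Ct root]; have Cn := gauss_map_of_class hyp.
have [[Cs _] ss sg [_ gm]] := hyp; set f := phi_of sigma nu tau.
have Cf : of_class 2 f.
  move=> c ac; have oU := @chart_im_open _ _ _ c.
  apply: (class_C_ext oU _ (class_C_add oU (class_C_le _ (Cn c ac))
    (class_C_mulmx oU (class_C_scalel (1%:M : 'M[R]_1) oU (Ct c ac))
      (class_C_le _ (Cs c ac))))) => // y Uy.
  by rewrite -scalemxAl mul1mx.
have fr c z : atlas M c -> chart_dom c z ->
    adapted_frame J (jacL c sigma z) (jacL c nu z) (sigma z) (nu z).
  move=> ac cz; have [_ _ _ [fr _]] := hypersurface_frame hyp ac cz.
  exact: fr (class_C_differentiable _ (Cn c ac) (chart_map_im cz)).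
have key c x ac cx := @mean_curvature_phi sigma nu tau c x
  (of_class_le (isT : 1 <= 4)%N Cs) (of_class_le (isT : 1 <= 3)%N Cn)
  (of_class_le (isT : 1 <= 2)%N Ct) Cf (fun z => fr c z ac) ac cx.
have sgf : induced_signature f.
  move=> c x ac cx; have [-> _ _] := key c x ac cx.
  by apply: has_signature_congr; [have [] := root c x ac cx|exact: sg].
have ff x : gram J (f x) (f x) = 1%:M.
  have [c ac cx] := atlas_cover x; have [s_s _ su uu _ _ _ _ _] := fr c x ac cx.
  rewrite /f /phi_of !gramDl !gramDr !gramZl !gramZr uu s_s su.
  by rewrite (gram_sym0 symJ su) !scaler0 !addr0.
split=> //.
- split=> // c x ac cx; split.
    exact: class_C_differentiable (Cf c ac) (chart_map_im cx).
  by apply: rank_jac; apply: has_signature_unit; exact: sgf.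
- by move=> x; apply: scalar_mx1_inj; rewrite -ipE; exact: ff.
move=> c x ac cx; have [_ Ds Hs] := key c x ac cx.
have [uX PX] := root c x ac cx.
have {}Hs : gram J (mean_curvature c f x) (sigma x) = 0.
  by rewrite (Hs uX) PX mulr0 raddf0 oppr0.
have uG := has_signature_unit (sgf c x ac cx).
have df := class_C_differentiable (ltn0Sn _) (Cf c ac) (chart_map_im cx).
have Df := gram_jac_self symJ cx df ff.
have [Hf HD] := mean_curvature_normal uG (ff x) Df.
have [s_s s0 su uu _ _ _ _ _] := fr c x ac cx.
have sf : gram J (sigma x) (f x) = 0.
  by rewrite /f /phi_of gramDr gramZr su s_s scaler0 addr0.
have DD : gram J (jacL c f x) (jacL c f x) \in unitmx by rewrite -metricE.
(* The mean curvature is orthogonal to f, d f and sigma, hence a multiple of the null vector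
   sigma. *)
have /submxP[v ->] := null_complement leN unitJ symJ (ff x) Df DD sf Ds s_s s0
  Hf HD Hs.
by apply: scalar_mx1_inj; rewrite -ipE gramMl gramMr s_s mul0mx mulmx0 raddf0.
Qed.

End Correspondence.

(** * From marginally trapped submanifolds to hypersurfaces *)

Section Converse.
Context (R : realType) (p q k : nat) (M : manifold R (p + q) k).
Local Notation N := (p.+2 + q.+1)%N.
Local Notation J := (ipform R p.+2 q.+1).
Local Notation Jl := (lform R p.+2 q.+1).
Local Notation Jr := (rform R p.+2 q.+1).
Implicit Types (c : chart R (p + q) M) (x : M) (f gam : M -> 'rV[R]_N).

Let leN : (N <= (p + q).+3)%N.
Proof. by rewrite !addSn addnS. Qed.

Let symJ : J^T = J.
Proof. exact: ipform_sym. Qed.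

Let unitJ : J \in unitmx.
Proof. exact: ipform_unit. Qed.

(** Counterpart of [hypersurface_frame]: the unit vector is now f, the null vector gam, and the
    non-degenerate block d f. *)
Lemma trapped_frame f gam c x : marginally_trapped f -> mean_gauss_map f gam ->
  atlas M c -> chart_dom c x ->
  [/\ gram Jl (gam x) (gam x) = 1%:M, gram Jr (gam x) (gam x) = 1%:M,
      gram J (gam x) (gam x) = 0, gram J (gam x) (f x) = 0 &
  [/\ gram J (f x) (f x) = 1%:M, gram J (jacL c f x) (gam x) = 0,
      gram J (jacL c f x) (f x) = 0 &
      gram J (jacL c f x) (jacL c f x) \in unitmx]].
Proof.
move=> [[Cf _] ff sg _] [_ gm] ac cx.
have [/sphere_productP[gl gr] gf gD] := gm x.
split=> //; first by rewrite gramB gl gr subrr.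
  by rewrite ipE gf raddf0.
have df := class_C_differentiable (ltn0Sn _) (Cf c ac) (chart_map_im cx).
split; first by rewrite ipE ff.
- apply: (gram_sym0 symJ); apply/rowP => i; rewrite gram_row ipE.
  have [/(_ i) gDi _] := gD c ac cx.
  by rewrite row_id -jacLE gDi !mxE mul0rn.
- apply: (gram_jac_self symJ cx df (w := 1%:M)) => z.
  by rewrite ipE ff.
- by rewrite -metricE; exact/has_signature_unit/sg.
Qed.

(** Locally gam is determined by orthogonality to f and d f and by having unit norm in each factor,
    which uses both quadratic slots of [class_C_implicit]. The coefficients contain d f, at the cost
    of one derivative. *)
Lemma mean_gauss_map_of_class m f gam : marginally_trapped f ->
  mean_gauss_map f gam -> of_class m.+1 f -> of_class m gam.
Proof.
move=> mt mg Cf c ac; have {}Cf := Cf c ac; have oU := @chart_im_open _ _ _ c.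
have [cgam _] := mg.
pose F := f \o chart_inv c.
pose B y := row_mx (J *m (F y)^T) (J *m ('J F y)^T).
have jacE y : chart_im c y -> 'J F y = jacL c f (chart_inv c y).
  by move=> Uy; rewrite -jacLE /jac chart_invK.
apply: (@class_C_implicit _ _ _ _ _ _ B Jl Jr 1%:M 1%:M _ oU).
- exact: lform_sym.
- exact: rform_sym.
- apply: (class_C_row_mx oU); apply: (class_C_mull _ oU); apply: (class_C_trmx oU).
    exact: class_CS Cf.
  exact: class_C_jacobian.
- by move=> y Uy; apply: continuous_comp; [exact: chart_inv_cont|exact: cgam].
- move=> y Uy; have cy := chart_inv_dom Uy.
  have [_ _ _ gf [_ Dg _ _]] := trapped_frame mt mg ac cy.
  rewrite /B !mul_mx_row !mulmxA -!/(gram _ _ _) /F /= gf jacE//.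
  by rewrite (gram_sym0 symJ Dg) row_mx0.
- move=> y Uy; have [gl _ _ _ _] := trapped_frame mt mg ac (chart_inv_dom Uy).
  by rewrite mulmxA.
- move=> y Uy; have [_ gr _ _ _] := trapped_frame mt mg ac (chart_inv_dom Uy).
  by rewrite mulmxA.
- move=> y h Uy; have cy := chart_inv_dom Uy.
  have [gl _ gg gf [ff Dg Df DD]] := trapped_frame mt mg ac cy.
  rewrite /B !mul_mx_row !mulmxA -!/(gram _ _ _) /F /= jacE//.
  rewrite -(row_mx0 R 1 1 (p + q)) => /eq_row_mx[hf hD] hl hr.
  apply: (null_frame_kernel unitJ symJ leN ff Df DD gf Dg gg gl hf hD _ hl).
  by rewrite gramB hl hr subrr.
Qed.

Lemma mean_gauss_jac f gam c x : marginally_trapped f ->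
  mean_gauss_map f gam -> of_class 1 gam -> atlas M c -> chart_dom c x ->
  [/\ gram J (jacL c gam x) (gam x) = 0, gram Jl (jacL c gam x) (gam x) = 0 &
      gram J (jacL c gam x) (f x) = 0].
Proof.
move=> mt mg Cg ac cx.
have pt z : [/\ gram Jl (gam z) (gam z) = 1%:M, gram J (gam z) (gam z) = 0 &
    gram J (gam z) (f z) = 0].
  have [c' ac' cz] := atlas_cover z.
  by have [? _ ? ? _] := trapped_frame mt mg ac' cz.
have [_ _ _ _ [_ Dg _ _]] := trapped_frame mt mg ac cx.
have [[Cf _] _ _ _] := mt.
have df := class_C_differentiable (ltn0Sn _) (Cf c ac) (chart_map_im cx).
have dg := class_C_differentiable (ltn0Sn _) (Cg c ac) (chart_map_im cx).
split.
- by apply: (gram_jac_self symJ cx dg (w := 0)) => z; have [] := pt z.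
- apply: (gram_jac_self (lform_sym _ _ _) cx dg (w := 1%:M)) => z.
  by have [] := pt z.
- by apply: (gram_jac_sym cx dg df (w := 0) _ Dg) => z; have [] := pt z.
Qed.

(* The differential of [gam] is [X] times that of [f] modulo [gam], and [X] is
   invertible because [gam] itself is not tangent to the product of spheres. *)
Lemma mean_gauss_map_signature f gam : marginally_trapped f ->
  mean_gauss_map f gam -> of_class 1 gam -> maximal_rank gam ->
  induced_signature gam.
Proof.
move=> mt mg Cg mr c x ac cx.
have [gl _ gg gf [ff Dg Df DD]] := trapped_frame mt mg ac cx.
have [_ _ sg _] := mt.
have [Sg Slg Sf] := mean_gauss_jac mt mg Cg ac cx.
have [v Sv] := weingarten unitJ symJ leN ff gg (gram_neq0 gl) gf Df Dg DD Sf Sg.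
have [SS _ _] := gram_phi symJ gg Dg Sv.
rewrite metricE SS; apply: has_signature_congr; last by rewrite -metricE; exact: sg.
rewrite -row_free_unit; apply: inj_row_free => w wX.
have wS : w *m jacL c gam x = (w *m v) *m gam x.
  rewrite {1}Sv mulmxDr -[RHS]add0r -[in RHS]mulmxA; congr (_ + _).
  by rewrite mulmxA wX mul0mx.
(* The product [lform] with gam reads off the coefficient of gam: it is 1 on gam and 0 on d gam. *)
have wv : w *m v = 0.
  by rewrite -[LHS]mulmx1 -gl -gramMl -wS gramMl Slg mulmx0.
have fS : row_free (jacL c gam x).
  by rewrite /row_free -jacLE; have [_ ->] := mr c x ac cx.
by apply: (row_free_inj fS); rewrite mul0mx wS wv mul0mx.
Qed.

Lemma marginally_trapped_phi f gam : (0 < p + q)%N ->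
  marginally_trapped f -> mean_gauss_map f gam ->
  of_class 4 gam -> maximal_rank gam ->
  exists (sigma nu : M -> 'rV[R]_N) (tau : M -> R^o),
    [/\ oriented_hypersurface sigma nu, is_root sigma nu tau &
        forall x, f x = phi_of sigma nu tau x].
Proof.
move=> n0 mt mg Cg mr; have [[Cf _] ff sg _] := mt; have [_ gm] := mg.
(* As <gam, f> = 0, the products of gam and f in the two factors coincide, so this one tau makes f -
   tau gam tangent to both spheres. *)
pose tau : M -> R^o := fun x => dot (lsubmx (gam x)) (lsubmx (f x)).
pose nu x := f x - (tau x : R) *: gam x.
have phiE : phi_of gam nu tau = f by apply/funext => x; rewrite /phi_of subrK.
have Cg1 : of_class 1 gam by exact: of_class_le Cg.
have Ct : of_class 2 tau.
  move=> c ac; have oU := @chart_im_open _ _ _ c.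
  apply: (class_C_ext oU _ (class_C_coord 0 0 oU (class_C_gram Jl oU
    (class_C_le _ (Cg c ac)) (Cf c ac)))) => // y Uy.
  by rewrite lformE mxE eqxx mulr1n.
have Cn : of_class 2 nu.
  move=> c ac; have oU := @chart_im_open _ _ _ c.
  apply: (class_C_ext oU _ (class_C_add oU (Cf c ac) (class_C_opp oU
    (class_C_mulmx oU (class_C_scalel (1%:M : 'M[R]_1) oU (Ct c ac))
      (class_C_le _ (Cg c ac)))))) => // y Uy.
  by rewrite -scalemxAl mul1mx.
have hyp : oriented_hypersurface gam nu.
  split.
  - by split.
  - by move=> x; have [] := gm x.
  - exact: mean_gauss_map_signature mt mg Cg1 mr.
  split; first exact: of_class_continuous Cn.
  move=> x; have [c0 ac0 cx0] := atlas_cover x.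
  have [gl gr gg gf [ffx _ _ _]] := trapped_frame mt mg ac0 cx0.
  have glf : gram Jl (gam x) (f x) = (tau x : R)%:M by rewrite lformE.
  have grf : gram Jr (gam x) (f x) = (tau x : R)%:M.
    by apply/esym/eqP; rewrite -subr_eq0 -glf -gramB gf.
  split.
  - apply/tangentP; rewrite /nu !gramDr !gramNr !gramZr gl gr glf grf.
    by rewrite scale_scalar_mx mulr1 subrr.
  - apply: scalar_mx1_inj; rewrite -ipE /nu !gramDl !gramNl !gramZl.
    rewrite !gramDr !gramNr !gramZr gg gf ffx (gram_sym0 symJ gf).
    by rewrite !(scaler0, subr0).
  - move=> c ac cx i; have [_ _ _ _ [_ Dg Df _]] := trapped_frame mt mg ac cx.
    have [Sg _ Sf] := mean_gauss_jac mt mg Cg1 ac cx.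
    have Snu : gram J (jacL c gam x) (nu x) = 0.
      by rewrite /nu gramDr gramNr gramZr Sf Sg scaler0 subr0.
    apply: scalar_mx1_inj; rewrite -ipE jacLE raddf0.
    by rewrite /gram -!row_mul -/(gram _ _ _) Snu row0.
exists gam, nu, tau; split=> //; last by rewrite phiE.
split=> // c x ac cx.
have fr z (cz : chart_dom c z) :
    adapted_frame J (jacL c gam z) (jacL c nu z) (gam z) (nu z).
  have [_ _ _ [fr _]] := hypersurface_frame hyp ac cz.
  exact: fr (class_C_differentiable _ (Cn c ac) (chart_map_im cz)).
have Cphi : of_class 2 (phi_of gam nu tau) by rewrite phiE.
have [DD _ Hg] := mean_curvature_phi Cg1 (of_class_le (isT : 1 <= 2)%N Cn)
  (of_class_le (isT : 1 <= 2)%N Ct) Cphi fr ac cx.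
(* The metric of f is X g X^T and non-degenerate, so X = tau - A is invertible. *)
have uX : (tau x)%:M - shape_operator c gam nu x \in unitmx.
  have := has_signature_unit (sg c x ac cx).
  by rewrite -phiE DD !unitmx_mul => /andP[/andP[]].
split=> //.
have [_ _ gD] := gm x; have [_ [l Hl]] := gD c ac cx.
have [_ _ gg _ _] := trapped_frame mt mg ac cx.
(* The mean curvature is l gam with gam null, so its product with gam vanishes; this product is -
   P(tau) / n, and n is positive. *)
have := Hg uX; rewrite phiE Hl gramZl gg scaler0 => /esym/eqP.
rewrite oppr_eq0 => /eqP P0; have {P0} : (p + q)%:R^-1 *
    P_of (shape_operator c gam nu x) (tau x) = 0.
  by apply: scalar_mx1_inj; rewrite P0 raddf0.
by move/eqP; rewrite mulf_eq0 invr_eq0 pnatr_eq0 (gtn_eqF n0) => /eqP.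
Qed.

End Converse.

Theorem theorem4 (R : realType) (p q : nat) (hn : (1 <= p + q)%N) :
  (forall (M : manifold R (p + q) 4) (sigma nu : M -> 'rV[R]_(p.+2 + q.+1)),
     oriented_hypersurface sigma nu ->
     (forall c x, atlas M c -> chart_dom c x ->
        let A := shape_operator c sigma nu x in
        exists2 Q : {poly R}, size Q = (p + q)%N &
          forall t : R, t%:M - A \in unitmx ->
            Q.[t] = \det (t%:M - A) * P_of A t) /\
     (forall tau : M -> R^o, is_root sigma nu tau ->
        marginally_trapped (phi_of sigma nu tau))) /\
  (forall (M : manifold R (p + q) 4) (f gam : M -> 'rV[R]_(p.+2 + q.+1)),
     connected [set: M] ->
     marginally_trapped f ->
     mean_gauss_map f gam ->
     of_class 4 gam \/ of_class 5 f ->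
     maximal_rank gam ->
     exists (sigma nu : M -> 'rV[R]_(p.+2 + q.+1)) (tau : M -> R^o),
       [/\ oriented_hypersurface sigma nu, is_root sigma nu tau &
           forall x, f x = phi_of sigma nu tau x]).
Proof.
split=> [M sigma nu hyp|M f gam _ mt mg reg mr].
  split=> [c x _ _ A|tau]; last exact: phi_marginally_trapped.
  (* Size p + q means degree n - 1; the leading coefficient n is nonzero in characteristic 0. *)
  by apply: tr_resolvent_poly; rewrite pnatr_eq0 -lt0n.
apply: (marginally_trapped_phi hn mt mg _ mr).
(* If f is of class C^5, the mean Gauss map is of class C^4, as required of sigma. *)
by case: reg => // Cf; exact: mean_gauss_map_of_class mt mg Cf.
Qed.
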